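(* Let $G$ be a locally compact Abelian group, and let $\Omega_{+},\Omega_{-}\subset G$ be boundary-coherent symmetric subsets such that $\Omega_{+}$ is a neighbourhood of $0$ having finite Haar measure. Then there exists a function $f\in\mathcal{F}_{G}(\Omega_{+},\Omega_{-})$ satisfying $\int_{G}f\,d\lambda_{G}=\mathcal{C}_{G}(\Omega_{+},\Omega_{-})$.
   Context: All locally compact Abelian (LCA) groups are Hausdorff, written additively with identity $0$, and $\lambda_G$ denotes a fixed Haar measure on $G$. A set $\Omega\subset G$ is symmetric if $\Omega=-\Omega$. A neighbourhood of $0$ is a set containing an open set that contains $0$. Here $A \subset B$ does not mean strict inclusion. A function $f:G\to\mathbb{R}$ is positive definite if $\sum_{i=1}^{n}\sum_{j=1}^{n}c_i\overline{c_j}f(g_i-g_j)\ge 0$ for all $n\in\mathbb{N}$, $c_i\in\mathbb{C}$, $g_i\in G$. $P_1(G)$ is the set of continuous positive definite functions $f:G\to\mathbb{R}$ with $f(0)=1$. For subsets $\Omega_+,\Omega_-\subset G$, $$\mathcal{F}_{G}(\Omega_{+},\Omega_{-}):=\{f\in P_1(G)\cap L^1(G): f^{-1}((0,\infty))\subset\Omega_{+},\ f^{-1}((-\infty,0))\subset\Omega_{-}\},$$ $$\mathcal{C}_{G}(\Omega_{+},\Omega_{-}):=\sup_{f\in\mathcal{F}_{G}(\Omega_{+},\Omega_{-})}\int_G f\,d\lambda_G,$$ with the convention that the value is $0$ if the class is empty. A subset $\Omega$ of a topological space $X$ is boundary-coherent if $\partial\Omega\subset\overline{\operatorname{ext}\Omega}$,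 where $\operatorname{ext}\Omega:=X\setminus\overline{\Omega}$. *)

(* Defs.v *)
From HB Require Import structures.
From mathcomp Require Import all_boot all_order all_algebra.
From mathcomp Require Import all_classical all_reals all_analysis.
From mathcomp Require Import complex.

Set Implicit Arguments.
Unset Strict Implicit.
Unset Printing Implicit Defensive.

Import Order.TTheory GRing.Theory Num.Theory.
Import numFieldTopology.Exports.

Local Open Scope classical_set_scope.
Local Open Scope ring_scope.

(* [g_sigma_algebraType] requires a pointed type, which a [topologicalZmodType]
   is not declared to be; this alias of [G] is pointed by [0]. *)
Definition borel (G : topologicalZmodType) : Type := G.

HB.instance Definition _ (G : topologicalZmodType) := Choice.on (borel G).
HB.instance Definition _ (G : topologicalZmodType) :=
  isPointed.Build (borel G) (0 : G).
HB.instance Definition _ (G : topologicalZmodType) :=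
  Measurable.copy (borel G)
    (g_sigma_algebraType (@open G : set (set (borel G)))).

Section definitions.
Context {R : realType} {G : topologicalZmodType}.
Implicit Types (mu : {measure set (borel G) -> \bar R}) (f : G -> R).

Definition lca_group (H : topologicalZmodType) : Prop :=
  hausdorff_space H /\ locally_compact [set: H].

Record haar_measure mu : Prop := HaarMeasure {
  haar_translation : forall (x : G) (A : set G),
    measurable (A : set (borel G)) -> mu [set x + a | a in A] = mu A ;
  haar_compact_fin : forall K : set G, compact K -> (mu K < +oo)%E ;
  haar_outer_regular : forall A : set G, measurable (A : set (borel G)) ->
    mu A = ereal_inf [set mu U | U in [set U : set G | open U /\ A `<=` U]] ;
  haar_inner_regular : forall U : set G, open U ->
    mu U = ereal_sup [set mu K | K in [set K : set G | compact K /\ K `<=` U]] ;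
  haar_neq0 : mu [set: G] <> 0%E }.

(* [A] need not be Borel: [mu^*] is the outer measure induced by [mu], and a
   set with finite [mu^*] is Caratheodory measurable iff it belongs to the
   completion of the Borel sigma-algebra with respect to [mu]. *)
Definition has_finite_haar_measure mu (A : set G) : Prop :=
  (mu^*)%mu.-cara.-measurable A /\ ((mu^*)%mu A < +oo)%E.

Definition symmetric_set (A : set G) : Prop := A = [set - x | x in A].

Definition topological_boundary (T : topologicalType) (A : set T) : set T :=
  closure A `\` A°.

Definition exterior (T : topologicalType) (A : set T) : set T := ~` closure A.

Definition boundary_coherent (T : topologicalType) (A : set T) : Prop :=
  topological_boundary A `<=` closure (exterior A).

(* The order of [R[i]] is partial: [0 <= z] states that [z] is real and
   nonnegative. *)
Definition positive_definite f : Prop :=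
  forall (n : nat) (c : 'I_n -> R[i]) (g : 'I_n -> G),
    0 <= \sum_(i < n) \sum_(j < n) c i * (c j)^*%C * (f (g i - g j))%:C%C.

Definition P1 : set (G -> R) :=
  [set f | [/\ continuous f, positive_definite f & f 0 = 1]].

Definition extremal_class mu (Wp Wm : set G) : set (G -> R) :=
  [set f | [/\ P1 f, mu.-integrable [set: borel G] (EFin \o f),
               f @^-1` [set y | 0 < y] `<=` Wp
             & f @^-1` [set y | y < 0] `<=` Wm]].

Definition extremal_const mu (Wp Wm : set G) : \bar R :=
  if `[< extremal_class mu Wp Wm !=set0 >]
  then ereal_sup [set (\int[mu]_x (f x)%:E)%E | f in extremal_class mu Wp Wm]
  else 0%E.

End definitions.

(* Main.v *)
Require Import Defs.
From mathcomp Require Import all_boot all_order all_algebra.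
From mathcomp Require Import all_classical all_reals all_analysis.
From mathcomp Require Import complex measurable_realfun.
From mathcomp Require Import ring lra.

Set Implicit Arguments.
Unset Strict Implicit.
Unset Printing Implicit Defensive.

Import Order.TTheory GRing.Theory Num.Theory.
Import numFieldNormedType.Exports.

Local Open Scope classical_set_scope.
Local Open Scope ring_scope.

(* Take a maximizing sequence [f n] whose L^2 norms are asymptotically minimal.
   Since the class is convex, the parallelogram law makes it L^2-Cauchy, and if
   the approximation is fast enough it converges almost everywhere.  Fatou's
   lemma, applied to [\1_B - f n] for a set [B] of finite measure containing
   [Wp], bounds the integral of the limit from below by the supremum.  A limit along an
   ultrafilter gives a positive definite [F], defined everywhere and equal to
   that limit almost everywhere, but possibly discontinuous.

   The continuous part [Fc] of [F] is obtained by the same minimization trick: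
   [F] is smeared by probability measures of almost minimal energy
   [\sum_p \sum_q p.1 * q.1 * F (p.2 - q.2)] with finite support in smaller and
   smaller neighbourhoods of [0].  Since the supports shrink to [0], smearing
   does not change integrals over sets of finite measure in the limit (so
   [Fc = F] almost everywhere), and it preserves signs on open sets, in
   particular on the exteriors of [Wp] and [Wm]; boundary coherence then extends
   the sign conditions by continuity.  Finally [Fc / Fc 0] is extremal. *)

(** * Positive definite functions as quadratic forms *)

(** Here [d] is the supremum over [i] of the infima of [q] on [S i]: an index almost reaching the
    supremum gives the lower bound, and every infimum is at most [d]. It serves twice, for energies
    of measures near [0] and for L^2 norms of almost maximal functions. *)
Lemma near_minimal {R : realType} {V I : Type} (i0 : I) (q : V -> R)
    (S : I -> set V) (M : R) :
  (forall v, 0 <= q v) -> (forall i, exists2 v, S i v & q v <= M) ->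
  exists d, forall e, 0 < e ->
    (exists i, forall v, S i v -> d - e <= q v) /\
    (forall i, exists2 v, S i v & q v <= d + e).
Proof.
move=> q0 SM; pose m i := inf [set q v | v in S i].
have hi i : has_inf [set q v | v in S i].
  by split; [have [v Sv _] := SM i; exists (q v), v | exists 0 => _ [v _ <-]].
have hs : has_sup (range m).
  split; first by exists (m i0), i0.
  exists M => _ [i _ <-]; have [v Sv] := SM i; apply: le_trans.
  by apply: ge_inf; [exact: (hi i).2 | exists v].
exists (sup (range m)) => e e0; split.
  have [_ [i _ <-] lti] := sup_adherent e0 hs.
  exists i => v Sv; apply: (le_trans (ltW lti)).
  by apply: ge_inf; [exact: (hi i).2 | exists v].
move=> i; have [_ [v Sv <-] ltv] := inf_adherent e0 (hi i).
exists v => //; apply: (le_trans (ltW ltv)); rewrite lerD2r.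
by apply: sup_ubound; [exact: hs.2 | exists i].
Qed.

Lemma cvg_sum_seq {R : realType} {T I : Type} (U : set_system T)
    {FU : Filter U} (r : seq I) (f : I -> T -> R) (l : I -> R) :
  (forall i, f i @ U --> l i) ->
  \sum_(i <- r) f i t @[t --> U] --> \sum_(i <- r) l i.
Proof.
move=> fl; elim: r => [|i r IH].
  rewrite big_nil; under eq_fun do rewrite big_nil; exact: cvg_cst.
by rewrite big_cons; under eq_fun do rewrite big_cons; exact: cvgD.
Qed.

Section gram.
Context {R : realType} {G : zmodType}.
Implicit Types (F : G -> R) (s t : seq (R * G)) (x : G).

(* A list of pairs (weight, point) stands for the measure
   [\sum_p p.1 \delta_(p.2)]. *)
Definition gram F s t : R :=
  \sum_(p <- s) \sum_(q <- t) p.1 * q.1 * F (p.2 - q.2).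

Definition wscale (a : R) s := [seq (a * p.1, p.2) | p <- s].

Definition wshift x s := [seq (p.1, x + p.2) | p <- s].

Definition real_positive_definite F :=
  (forall x, F (- x) = F x) /\ forall s, 0 <= gram F s s.

Lemma gram_catl F s1 s2 t : gram F (s1 ++ s2) t = gram F s1 t + gram F s2 t.
Proof. by rewrite /gram big_cat. Qed.

Lemma gram_catr F s t1 t2 : gram F s (t1 ++ t2) = gram F s t1 + gram F s t2.
Proof.
by rewrite /gram -big_split /=; apply: eq_bigr => p _; rewrite big_cat.
Qed.

Lemma gram_scalel F a s t : gram F (wscale a s) t = a * gram F s t.
Proof.
rewrite /gram big_map mulr_sumr; apply: eq_bigr => p _ /=.
by rewrite mulr_sumr; apply: eq_bigr => q _; rewrite !mulrA.
Qed.

Lemma gram_scaler F a s t : gram F s (wscale a t) = a * gram F s t.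
Proof.
rewrite /gram mulr_sumr; apply: eq_bigr => p _ /=.
rewrite big_map mulr_sumr; apply: eq_bigr => q _ /=; ring.
Qed.

Lemma gramC F s t : (forall x, F (- x) = F x) -> gram F s t = gram F t s.
Proof.
move=> eF; rewrite /gram exchange_big /=; apply: eq_bigr => p _.
by apply: eq_bigr => q _; rewrite -(eF (p.2 - q.2)) opprB (mulrC p.1).
Qed.

Lemma gram_shift F x s t : gram F (wshift x s) (wshift x t) = gram F s t.
Proof.
rewrite /gram big_map; apply: eq_bigr => p _ /=.
by rewrite big_map; apply: eq_bigr => q _ /=; rewrite opprD addrACA subrr add0r.
Qed.

Lemma wshiftD x y s : wshift (x + y) s = wshift x (wshift y s).
Proof. by rewrite /wshift -map_comp; apply: eq_map => p /=; rewrite addrA. Qed.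

Section form.
Variable F : G -> R.
Hypothesis pdF : real_positive_definite F.

(** The quadratic polynomial [l |-> gram F (s + l t) (s + l t)] is nonnegative. *)
Lemma gram_cauchy_schwarz s t :
  gram F s t ^+ 2 <= gram F s s * gram F t t.
Proof.
have [eF pF] := pdF.
have H (l : R) :
    0 <= gram F s s + 2 * l * gram F s t + l ^+ 2 * gram F t t.
  have := pF (s ++ wscale l t).
  rewrite !gram_catl !gram_catr !gram_scalel !gram_scaler (gramC t s eF).
  by congr (_ <= _); ring.
move: (pF s) (pF t) H.
move: (gram F s s) (gram F s t) (gram F t t) => a b c a0 c0 H.
have [c00|cn0] := eqVneq c 0.
  subst c; rewrite mulr0; have [->|bn0] := eqVneq b 0; first by rewrite expr0n.
  (* With [c = 0] the polynomial is affine; this [l] gives it the value [-1]. *)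
  have := H (- (a + 1) / (2 * b)).
  have -> : a + 2 * (- (a + 1) / (2 * b)) * b +
    (- (a + 1) / (2 * b)) ^+ 2 * 0 = -1 by field.
  lra.
(* The minimizer of the polynomial. *)
have := H (- b / c); have cp : 0 < c by rewrite lt_neqAle eq_sym cn0.
have -> : a + 2 * (- b / c) * b + (- b / c) ^+ 2 * c = (a * c - b ^+ 2) / c.
  by field.
by rewrite pmulr_lge0 ?invr_gt0// subr_ge0.
Qed.

Lemma gram_norm_le s t :
  `|gram F s t| <= Num.sqrt (gram F s s) * Num.sqrt (gram F t t).
Proof.
rewrite -sqrtrM ?pdF.2// -sqrtr_sqr ler_sqrt ?gram_cauchy_schwarz//.
by rewrite mulr_ge0 ?pdF.2.
Qed.

(** Concatenation adds measures, so the two lists on the left are the midpoint and the difference of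
    [s] and [t]. *)
Lemma gram_parallelogram s t :
  gram F (wscale 2^-1 (s ++ t)) (wscale 2^-1 (s ++ t)) *+ 4 +
  gram F (s ++ wscale (-1) t) (s ++ wscale (-1) t) =
  (gram F s s + gram F t t) *+ 2.
Proof.
rewrite !(gram_scalel, gram_scaler, gram_catl, gram_catr).
by rewrite (gramC t s pdF.1); field.
Qed.

(** Cauchy-Schwarz for the unit masses at [x] and [0]. *)
Lemma posdef_norm_le x : `|F x| <= F 0.
Proof.
have /(_ [:: (1, x)] [:: (1, 0)]) := gram_norm_le.
rewrite /gram !big_seq1 /= !mul1r !subr0 subrr -expr2 sqr_sqrtr//.
by have := pdF.2 [:: (1, 0)]; rewrite /gram !big_seq1 /= !mul1r subrr.
Qed.

End form.

(** The list [st] is the convolution of [s] and [t]; hence smearing a positive definite function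
    keeps it positive definite. *)
Lemma gram_prod F s t :
  gram (fun x => gram F (wshift x t) t) s s =
  let st := [seq (p.1 * a.1, p.2 + a.2) | p <- s, a <- t] in gram F st st.
Proof.
rewrite /= /gram big_allpairs_dep /=; apply: eq_bigr => p _.
under [RHS]eq_bigr do rewrite big_allpairs_dep /=.
rewrite exchange_big /=; apply: eq_bigr => q _.
rewrite big_map mulr_sumr; apply: eq_bigr => a _ /=.
rewrite mulr_sumr; apply: eq_bigr => b _ /=.
have -> : p.2 + a.2 - (q.2 + b.2) = p.2 - q.2 + a.2 - b.2.
  by rewrite opprD addrACA !addrA.
ring.
Qed.

Lemma posdef_scale F (c : R) : 0 <= c -> real_positive_definite F ->
  real_positive_definite (fun x => c * F x).
Proof.
move=> c0 [eF pF]; split=> [x|s]; first by rewrite eF.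
suff -> : gram (fun x => c * F x) s s = c * gram F s s by rewrite mulr_ge0.
rewrite /gram mulr_sumr; apply: eq_bigr => p _.
by rewrite mulr_sumr; apply: eq_bigr => q _; ring.
Qed.

Lemma posdefD F1 F2 : real_positive_definite F1 -> real_positive_definite F2 ->
  real_positive_definite (fun x => F1 x + F2 x).
Proof.
move=> [e1 p1] [e2 p2]; split=> [x|s]; first by rewrite e1 e2.
suff -> : gram (fun x => F1 x + F2 x) s s = gram F1 s s + gram F2 s s.
  by rewrite addr_ge0.
rewrite /gram -big_split; apply: eq_bigr => p _.
by rewrite -big_split; apply: eq_bigr => q _ /=; ring.
Qed.

(** Each [gram] is a finite sum, so pointwise convergence along any proper filter is enough; this
    covers both the ultrafilter and the filter of almost minimal measures. *)
Lemma posdef_lim (T : Type) (U : set_system T) {FU : ProperFilter U}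
    (f : T -> G -> R) F :
  (forall i, real_positive_definite (f i)) ->
  (forall x, f^~ x @ U --> F x) -> real_positive_definite F.
Proof.
move=> pf fF; split=> [x|s].
  have fxN : f^~ (- x) = f^~ x by apply/funext => i; rewrite (pf i).1.
  rewrite -(cvg_lim (@norm_hausdorff _ R) (fF x)).
  by rewrite -(cvg_lim (@norm_hausdorff _ R) (fF (- x))) fxN.
have cg : gram (f i) s s @[i --> U] --> gram F s s.
  apply: cvg_sum_seq => p; apply: cvg_sum_seq => q.
  by apply: cvgM; [exact: cvg_cst | exact: fF].
rewrite -(cvg_lim (@norm_hausdorff _ R) cg).
apply: limr_ge; first by apply/cvg_ex; eexists; exact: cg.
by near do exact: (pf _).2.
Unshelve. all: by end_near. Qed.

End gram.

(** For an even [f], the real part of the complex form is the sum of the real forms at the real and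
    the imaginary parts of the coefficients, and the imaginary part cancels by antisymmetry. *)
Lemma positive_definiteP {R : realType} {G : topologicalZmodType} (f : G -> R) :
  positive_definite f <-> real_positive_definite f.
Proof.
split=> [pf|[ef pf] n c g].
  split=> [x|s].
    (* Coefficients [1] and [i] at the points [0] and [x] give a form with imaginary part
       [f x - f (- x)], which must vanish. *)
    have := pf 2%N (fun i => if i == ord0 then 1 else 'i%C)
                (fun i => if i == ord0 then 0 else x).
    rewrite !big_ord_recl !big_ord0 /= !sub0r !subr0 subrr.
    rewrite lecE /= => /andP[/eqP h _]; move: h; simpc => h; lra.
  have := pf (size s) (fun i => (s`_i).1%:C%C) (fun i => (s`_i).2).
  suff -> : (\sum_(i < size s) \sum_(j < size s) (s`_i).1%:C%C *
      ((s`_j).1%:C)^*%C * (f ((s`_i).2 - (s`_j).2))%:C%C)%C = (gram f s s)%:C%C.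
    by rewrite lecR.
  rewrite /gram (big_nth 0) big_mkord rmorph_sum; apply: eq_bigr => i _ /=.
  rewrite (big_nth 0) big_mkord rmorph_sum; apply: eq_bigr => j _ /=.
  by rewrite !rmorphM /=; congr (_ * _ * _); rewrite /conjc /= oppr0.
pose s k : seq (R * G) := [seq (k (c i), g i) | i <- enum 'I_n].
have gE k : gram f (s k) (s k) =
    \sum_(i < n) \sum_(j < n) k (c i) * k (c j) * f (g i - g j).
  rewrite /gram big_map big_enum /=; apply: eq_bigr => i _.
  by rewrite big_map big_enum.
rewrite lecE; apply/andP; split.
  rewrite (raddf_sum (@complex.Im R)) /=.
  under eq_bigr do rewrite (raddf_sum (@complex.Im R)) /=.
  pose h i j := (complex.Im (c i) * complex.Re (c j) -
                 complex.Re (c i) * complex.Im (c j)) * f (g i - g j).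
  rewrite (eq_bigr (fun i => \sum_(j < n) h i j)); last first.
    move=> i _; apply: eq_bigr => j _; rewrite /h.
    by case: (c i) => a b; case: (c j) => a' b'; simpc => /=; ring.
  (* Exchanging [i] and [j] changes the sign of [h], since [f] is even. *)
  have : \sum_(i < n) \sum_(j < n) h i j = - \sum_(i < n) \sum_(j < n) h i j.
    rewrite [LHS]exchange_big -sumrN; apply: eq_bigr => i _.
    rewrite -sumrN; apply: eq_bigr => j _.
    by rewrite /h -(ef (g i - g j)) opprB; ring.
  by move=> /eqP; rewrite -addr_eq0 -mulr2n mulrn_eq0.
rewrite (raddf_sum (@complex.Re R)) /=.
have := addr_ge0 (pf (s (@complex.Re R))) (pf (s (@complex.Im R))).
rewrite !gE -big_split /=; congr (_ <= _); apply: eq_bigr => i _.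
rewrite (raddf_sum (@complex.Re R)) -big_split /=; apply: eq_bigr => j _.
by case: (c i) => a b; case: (c j) => a' b'; simpc => /=; ring.
Qed.

(** * The continuous part of a positive definite function *)

Section smear.
Context {R : realType} {G : zmodType}.
Implicit Types (F : G -> R) (s t : seq (R * G)) (x : G) (U : set G).

Definition prob_in U t :=
  (forall p, p \in t -> 0 <= p.1 /\ U p.2) /\ \sum_(p <- t) p.1 = 1.

(** For a probability measure [t], this is the mean of [F (x + a - b)] with [a] and [b] drawn
    independently from [t], that is, [F] convolved with [t] and with its reflection. *)
Definition smear F t x := gram F (wshift x t) t.

Lemma prob_in_sub U V t : U `<=` V -> prob_in U t -> prob_in V t.
Proof. by move=> UV [tU t1]; split=> // p /tU[? /UV]. Qed.

Lemma smearE F t x :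
  smear F t x = \sum_(p <- t) \sum_(q <- t) p.1 * q.1 * F (x + p.2 - q.2).
Proof. by rewrite /smear /gram big_map. Qed.

Lemma smearN F t x : smear (fun y => - F y) t x = - smear F t x.
Proof.
rewrite !smearE -sumrN; apply: eq_bigr => p _; rewrite -sumrN.
by apply: eq_bigr => q _; rewrite mulrN.
Qed.

Lemma sum_weights U t c : prob_in U t ->
  \sum_(p <- t) \sum_(q <- t) p.1 * q.1 * c = c.
Proof.
move=> [_ t1]; under eq_bigr do rewrite -mulr_suml -mulr_sumr t1 mulr1.
by rewrite -mulr_suml t1 mul1r.
Qed.

Lemma smear_le F U t x c : prob_in U t ->
  (forall a b, U a -> U b -> F (x + a - b) <= c) -> smear F t x <= c.
Proof.
move=> tU Fc; rewrite smearE -[leRHS](sum_weights c tU).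
rewrite !big_seq; apply: ler_sum => p pt.
rewrite !big_seq; apply: ler_sum => q qt.
have [p0 Up] := tU.1 p pt; have [q0 Uq] := tU.1 q qt.
by apply: ler_wpM2l; [exact: mulr_ge0 | exact: Fc].
Qed.

Lemma smear_ge F U t x c : prob_in U t ->
  (forall a b, U a -> U b -> c <= F (x + a - b)) -> c <= smear F t x.
Proof.
move=> tU Fc; rewrite -lerN2 -smearN; apply: smear_le tU _ => a b Ua Ub.
by rewrite lerN2; exact: Fc.
Qed.

Lemma smear0 F t : smear F t 0 = gram F t t.
Proof.
by rewrite /smear; congr gram; rewrite -[RHS]map_id; apply: eq_map => -[a b] /=;
  rewrite add0r.
Qed.

Lemma posdef_smear F t : real_positive_definite F ->
  real_positive_definite (smear F t).
Proof.
move=> pF; split=> [x|s]; last by rewrite gram_prod; exact: pF.2.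
rewrite /smear (gramC _ _ pF.1) -(gram_shift F x); congr gram.
rewrite -wshiftD addrN -[RHS]map_id.
by apply: eq_map => -[a b] /=; rewrite add0r.
Qed.

Lemma prob_mid U s t : prob_in U s -> prob_in U t ->
  prob_in U (wscale 2^-1 (s ++ t)).
Proof.
move=> [sU s1] [tU t1]; split; last first.
  by rewrite big_map -mulr_sumr big_cat /= s1 t1 -div1r; lra.
move=> p /mapP[q]; rewrite mem_cat => /orP[/sU|/tU] [q0 Uq] ->;
  by split=> //=; rewrite mulr_ge0// invr_ge0.
Qed.

Section bounds.
Variable F : G -> R.
Hypothesis pdF : real_positive_definite F.
Hypothesis F01 : F 0 = 1.

Lemma gram_prob_le1 U t : prob_in U t -> gram F t t <= 1.
Proof.
move=> tU; rewrite -smear0; apply: smear_le tU _ => a b _ _.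
by rewrite (le_trans (ler_norm _))// -F01; exact: posdef_norm_le.
Qed.

(** By bilinearity the difference is a sum of two pairings of the signed measure [s - t] with
    translates of [s] and [t], whose energies are at most [1]. Closeness in energy thus gives
    uniform closeness of the smeared functions. *)
Lemma smear_dist U s t x : prob_in U s -> prob_in U t ->
  `|smear F s x - smear F t x| <=
  2 * Num.sqrt (gram F (s ++ wscale (-1) t) (s ++ wscale (-1) t)).
Proof.
move=> sU tU; set u := s ++ _.
have -> : smear F s x - smear F t x =
    gram F (wshift x u) s + gram F (wshift x t) u.
  have -> : wshift x u = wshift x s ++ wscale (-1) (wshift x t).
    by rewrite /wshift /u map_cat; congr cat; rewrite /wscale -!map_comp.
  rewrite /u gram_catl gram_catr gram_scalel gram_scaler /smear; ring.
have sq1 v : prob_in U v -> Num.sqrt (gram F v v) <= 1.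
  by move=> vU; rewrite -[leRHS]sqrtr1 ler_wsqrtr// (gram_prob_le1 vU).
rewrite (le_trans (ler_normD _ _))// mulrDl mul1r lerD//.
  rewrite (le_trans (gram_norm_le pdF _ _))// gram_shift.
  by rewrite ler_piMr ?sqrtr_ge0// sq1.
rewrite (le_trans (gram_norm_le pdF _ _))// gram_shift.
by rewrite ler_piMl ?sqrtr_ge0// sq1.
Qed.

(** The difference is a single pairing of [t] with a translate of the signed measure obtained from
    [t] by shifting by [x - y] and subtracting [t]. *)
Lemma smear_shift_dist U t x y : prob_in U t ->
  `|smear F t x - smear F t y| <= Num.sqrt (gram F
     (wshift (x - y) t ++ wscale (-1) t) (wshift (x - y) t ++ wscale (-1) t)).
Proof.
move=> tU; set u := wshift _ _ ++ _.
have -> : smear F t x - smear F t y = gram F (wshift y u) t.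
  have -> : wshift y u = wshift x t ++ wscale (-1) (wshift y t).
    rewrite /u {1}/wshift map_cat -/(wshift y _) -wshiftD addrC subrK.
    by congr cat; rewrite /wscale /wshift -!map_comp.
  rewrite gram_catl gram_scalel /smear; ring.
rewrite (le_trans (gram_norm_le pdF _ _))// gram_shift ler_piMr ?sqrtr_ge0//.
by rewrite -[leRHS]sqrtr1 ler_wsqrtr// (gram_prob_le1 tU).
Qed.

End bounds.
End smear.

Lemma group_cvgD {G : topologicalZmodType} {T : Type} (F : set_system T)
    {FF : Filter F} (f g : T -> G) (a b : G) :
  f @ F --> a -> g @ F --> b -> f t + g t @[t --> F] --> a + b.
Proof. exact: (continuous2_cvg (h := +%R) _ (add_continuous (a, b))). Qed.

Lemma group_cvgB {G : topologicalZmodType} {T : Type} (F : set_system T)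
    {FF : Filter F} (f g : T -> G) (a b : G) :
  f @ F --> a -> g @ F --> b -> f t - g t @[t --> F] --> a - b.
Proof.
move=> fa gb; apply: group_cvgD fa _.
exact: (continuous_cvg _ (@opp_continuous G b) gb).
Qed.

Lemma group_cvg_shift {G : topologicalZmodType} (c a : G) :
  z + c @[z --> a] --> a + c.
Proof. by apply: group_cvgD; [exact: cvg_id | exact: cvg_cst]. Qed.

(* [Fc] is the continuous part of [F]: among the probability measures carried
   by small neighbourhoods of [0], those of almost minimal [F]-energy form a
   Cauchy family, and small translations do not leave that family. *)
Lemma continuous_part {R : realType} {G : topologicalZmodType} (F : G -> R) :
  real_positive_definite F -> F 0 = 1 ->
  exists Fc : G -> R, [/\ real_positive_definite Fc, continuous Fc, Fc 0 <= 1 &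
    forall e V, 0 < e -> nbhs (0 : G) V ->
      exists2 t, prob_in V t & forall x, `|Fc x - smear F t x| <= e].
Proof.
move=> pdF F01.
pose I := {U : set G | nbhs (0 : G) U}.
pose S (i : I) : set (seq (R * G)) := prob_in (sval i).
pose q (t : seq (R * G)) := gram F t t.
have S1 i : exists2 t, S i t & q t <= 1.
  (* The unit mass at [0] lies in every neighbourhood and has energy [F 0 = 1]. *)
  exists [:: (1, 0)]; last by rewrite /q /gram !big_seq1 /= !mul1r subrr F01.
  split; last by rewrite big_seq1.
  move=> p; rewrite inE => /eqP -> /=; split=> //.
  by case: i => U /= /nbhs_singleton.
have [d Hd] := near_minimal (exist _ setT filterT : I) pdF.2 S1.
pose B U eta : set (seq (R * G)) := [set t | prob_in U t /\ q t <= d + eta].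
have B_neq0 U eta : nbhs (0 : G) U -> 0 < eta -> B U eta !=set0.
  by move=> U0 eta0; have [t tU qt] := (Hd _ eta0).2 (exist _ U U0); exists t.
have Bsub U V eta eta' : U `<=` V -> eta <= eta' -> B U eta `<=` B V eta'.
  move=> UV ee t [tU qt]; split; first exact: prob_in_sub UV tU.
  by rewrite (le_trans qt)// lerD2l.
have Bl U V eta eta' : B (U `&` V) (Num.min eta eta') `<=` B U eta.
  by apply: Bsub; [exact: subIsetl | rewrite ge_min lexx].
have Br U V eta eta' : B (U `&` V) (Num.min eta eta') `<=` B V eta'.
  by apply: Bsub; [exact: subIsetr | rewrite ge_min lexx orbT].
have H e : 0 < e -> exists U eta, [/\ open_nbhs (0 : G) U, 0 < eta &
    forall s t, B U eta s -> B U eta t ->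
    q (s ++ wscale (-1) t) <= e].
  (* The midpoint of [s] and [t] is again carried by [U], so its energy is at least [d - e / 8]. The
     parallelogram law bounds the energy of the difference by
     [4 * (d + e / 8) - 4 * (d - e / 8) = e]. *)
  move=> e0; have e8 : 0 < e / 8 by rewrite divr_gt0.
  have [[[U U0] /= SU] _] := Hd _ e8.
  exists U°, (e / 8); split=> //; first by split; [exact: open_interior | exact: U0].
  move=> s t [sU qs] [tU qt].
  have := gram_parallelogram pdF s t.
  have := SU (wscale 2^-1 (s ++ t))
    (prob_in_sub (@interior_subset _ _) (prob_mid sU tU)).
  by move: qs qt; rewrite /q; lra.
have Hs e : 0 < e -> exists U eta, [/\ open_nbhs (0 : G) U, 0 < eta &
    forall s t, B U eta s -> B U eta t ->
    Num.sqrt (q (s ++ wscale (-1) t)) <= e].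
  move=> e0; have [U [eta [oU eta0 HU]]] := H _ (exprn_gt0 2 e0).
  exists U, eta; split=> // s t Bs Bt; rewrite -(ger0_norm (ltW e0)) -sqrtr_sqr.
  by rewrite ler_wsqrtr// HU.
pose base := [set p : set G * R | nbhs (0 : G) p.1 /\ 0 < p.2].
(* The sets [B U eta] of almost minimal measures generate a proper filter; [Fc] is the limit of the
   smeared functions along it. *)
pose Phi := filter_from base (fun p => B p.1 p.2).
have PF : ProperFilter Phi.
  apply: filter_from_proper; last by move=> [U eta] [/= U0 e0]; exact: B_neq0.
  apply: filter_from_filter.
    by exists (setT, 1); split=> //=; exact: filterT.
  move=> [U eta] [V eta'] [/= U0 e0] [/= V0 e0'].
  exists (U `&` V, Num.min eta eta'); first split=> /=.
  - exact: filterI.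
  - by rewrite lt_min e0.
  - by move=> t Bt; split; [exact: Bl Bt | exact: Br Bt].
have smcvg x : cvg (smear F t x @[t --> Phi]).
  apply: cauchy_cvg; apply: cauchy_exP => e e0.
  have [U [eta [oU eta0 HU]]] := Hs _ (divr_gt0 e0 (ltr0Sn R 3)).
  have [s Bs] := B_neq0 U eta (open_nbhs_nbhs oU) eta0.
  exists (smear F s x), (U, eta); first by split=> //; exact: open_nbhs_nbhs.
  move=> t /= Bt; rewrite /= -ball_normE /ball_ /=.
  rewrite (le_lt_trans (smear_dist pdF F01 x Bs.1 Bt.1))//.
  by have := HU _ _ Bs Bt; rewrite /q; lra.
pose Fc x := lim (smear F t x @[t --> Phi]).
have approx e : 0 < e -> exists U eta, [/\ open_nbhs (0 : G) U, 0 < eta &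
    forall t, B U eta t -> forall x, `|Fc x - smear F t x| <= e].
  move=> e0; have [U [eta [oU eta0 HU]]] := Hs _ (divr_gt0 e0 (ltr0Sn R 1)).
  exists U, eta; split=> // s Bs x.
  have cn : `|smear F t x - smear F s x| @[t --> Phi] --> `|Fc x - smear F s x|.
    by apply: cvg_norm; apply: cvgB; [exact: smcvg | exact: cvg_cst].
  rewrite -(cvg_lim (@norm_hausdorff _ R) cn).
  apply: limr_le; first by apply/cvg_ex; eexists; exact: cn.
  exists (U, eta); first by split=> //; exact: open_nbhs_nbhs.
  move=> t /= Bt.
  rewrite (le_trans (smear_dist pdF F01 x Bt.1 Bs.1))//.
  by have := HU _ _ Bt Bs; rewrite /q; lra.
have approxV e V : 0 < e -> nbhs (0 : G) V ->
      exists2 t, prob_in V t & forall x, `|Fc x - smear F t x| <= e.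
  move=> e0 V0; have [U [eta [oU eta0 HU]]] := approx _ e0.
  have [t Bt] := B_neq0 (U `&` V) eta (filterI (open_nbhs_nbhs oU) V0) eta0.
  exists t; first exact: prob_in_sub (@subIsetr _ _ _) Bt.1.
  by apply: HU; apply: Bsub Bt => //; exact: subIsetl.
exists Fc; split=> //.
- apply: (posdef_lim (U := Phi) (f := smear F)) => [t|x]; last exact: smcvg.
  exact: posdef_smear.
- move=> x; apply/cvgrPdist_le => /= e e0.
  have e3 : 0 < e / 3 by rewrite divr_gt0.
  have [U [eta [oU eta0 HU]]] := Hs _ e3.
  have [U' [eta' [oU' eta0' HU']]] := approx _ e3.
  have [t Bt] := B_neq0 (U `&` U') (Num.min eta eta')
    (filterI (open_nbhs_nbhs oU) (open_nbhs_nbhs oU'))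
    (ltac:(by rewrite lt_min eta0)).
  have BtU : B U eta t := Bl _ _ _ _ _ Bt.
  have BtU' : B U' eta' t := Br _ _ _ _ _ Bt.
  (* The finitely many points of [t] lie in the open set [U] and stay there under small
     translations. A translate of [t] has the same energy, so it is again in [B U eta], hence close
     to [t]; this gives the middle term of the [e / 3] estimate below. *)
  have tnbhs : \forall z \near (0 : G), prob_in U (wshift z t).
    have zU : \forall z \near (0 : G), forall p, p \in t -> U (z + p.2).
      have {BtU}: forall p, p \in t -> U p.2 by move=> p /BtU.1.1[].
      elim: t {Bt BtU'} => [|p t IH] tU; first by near=> z.
      have Up : U p.2 by apply: tU; rewrite inE eqxx.
      have /IH{}IH : forall p, p \in t -> U p.2.
        by move=> r rt; apply: tU; rewrite inE rt orbT.
      have Up' : \forall z \near (0 : G), U (z + p.2).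
        have := @group_cvg_shift G p.2 0.
        rewrite add0r => /(_ U); apply; apply: open_nbhs_nbhs.
        by split=> //; exact: oU.1.
      near=> z; move=> r; rewrite inE => /orP[/eqP ->|]; first by near: z.
      by move: r; near: z.
    near=> z; split; last by rewrite big_map BtU.1.2.
    move=> _ /mapP[p pt ->] /=; split; first exact: (BtU.1.1 _ pt).1.
    by move: p pt; near: z.
  have key z : prob_in U (wshift z t) -> forall y,
      `|Fc (z + y) - Fc y| <= e.
    move=> zt y.
    have Bz : B U eta (wshift z t) by split=> //; rewrite /q gram_shift; exact: BtU.2.
    have := HU _ _ Bz BtU.
    have := smear_shift_dist pdF F01 (z + y) y BtU.1; rewrite addrK -/(q _).
    have := HU' _ BtU' (z + y); have := HU' _ BtU' y.
    move=> a1 a2 a3 a4; rewrite -(subrKA (smear F t (z + y))).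
    rewrite (le_trans (ler_normD _ _))//.
    rewrite -[_ - Fc y](subrKA (smear F t y)).
    have := ler_normD (smear F t (z + y) - smear F t y) (smear F t y - Fc y).
    rewrite (distrC (smear F t y)); lra.
  have := @group_cvg_shift G (- x) x; rewrite subrr => /(_ _ tnbhs) nx.
  have {}nx : \forall y \near x, prob_in U (wshift (y - x) t) := nx.
  apply: filterS nx => y /key /(_ x).
  by rewrite subrK distrC.
- apply/ler_addgt0Pl => e e0.
  have [t tU /(_ 0)] := approxV e setT e0 filterT.
  have := gram_prob_le1 pdF F01 tU; rewrite smear0 => h1.
  by rewrite ler_norml => /andP[_]; lra.
Unshelve. all: by end_near. Qed.

(** * Haar measure and translations *)

Lemma compact_shift_near {G : topologicalZmodType} (K U : set G) :
  compact K -> open U -> K `<=` U ->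
  \forall c \near (0 : G), forall x, K x -> U (c + x).
Proof.
move=> /compact_near_coveringP cK oU KU.
apply: (cK G (nbhs (0 : G)) (fun c x => U (c + x))) => x Kx.
have /(_ U) : fst z + snd z @[z --> ((0 : G), x)] --> 0 + x.
  exact: (@add_continuous G (0, x)).
rewrite add0r => /(_ (open_nbhs_nbhs (conj oU (KU _ Kx)))) [[A B] /= [A0 Bx] AB].
exists (B, A) => //= -[y c] [/= By Ac]; exact: (AB (c, y)).
Qed.

Section borel.
Context {R : realType} {G : topologicalZmodType}.

Lemma borel_open (U : set G) : open U -> measurable (U : set (borel G)).
Proof. by move=> oU; exact: sub_sigma_algebra. Qed.

Lemma borel_compact (K : set G) : hausdorff_space G -> compact K ->
  measurable (K : set (borel G)).
Proof.
move=> hG cK; rewrite -(setCK K); apply: measurableC; apply: borel_open.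
by rewrite openC; exact: compact_closed.
Qed.

Lemma borel_shift (c : G) :
  measurable_fun setT ((fun x => c + x) : borel G -> borel G).
Proof.
apply: (@measurability _ _ (borel G) (borel G) setT _ (@open G)) => //.
move=> _ [U oU <-]; rewrite setTI; apply: borel_open.
by apply: open_comp => // x _; apply: group_cvgD; [exact: cvg_cst | exact: cvg_id].
Qed.

Lemma borel_continuous (f : G -> R) : continuous f ->
  measurable_fun setT (f : borel G -> R).
Proof.
move=> cf; apply: (measurability _ (RGenOInfty.measurableE R)).
move=> _ [_ [a ->] <-]; rewrite setTI; apply: borel_open.
by apply: open_comp; [move=> x _; exact: cf | exact: interval_open].
Qed.

Lemma shift_preimage (c : G) (A : set G) :
  [set c + a | a in A] = (fun x => - c + x) @^-1` A.
Proof.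
apply/seteqP; split=> [_ [a Aa <-]|x Ax] /=; first by rewrite addKr.
by exists (- c + x) => //; rewrite addNKr.
Qed.

Lemma borel_shift_image (c : G) (A : set G) : measurable (A : set (borel G)) ->
  measurable ([set c + a | a in A] : set (borel G)).
Proof.
move=> mA; rewrite shift_preimage -[X in measurable X]setTI.
exact: borel_shift.
Qed.

End borel.
Section haar.
Context {R : realType} {G : topologicalZmodType}.
Variable lam : {measure set (borel G) -> \bar R}.
Hypothesis hG : hausdorff_space G.
Hypothesis hlam : haar_measure lam.

Lemma haar_shift_preimage c (A : set G) : measurable (A : set (borel G)) ->
  lam ((fun x => c + x) @^-1` A) = lam A.
Proof.
by move=> mA; rewrite -(opprK c) -shift_preimage (haar_translation hlam).
Qed.

Lemma bounded_finite_integrable (A : set G) (g : G -> R) :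
  measurable (A : set (borel G)) -> (lam A < +oo)%E ->
  measurable_fun setT (g : borel G -> R) -> (forall x, `|g x| <= 1) ->
  lam.-integrable (A : set (borel G)) (EFin \o g).
Proof.
move=> mA fA mg g1; apply: measurable_bounded_integrable => //.
  exact: measurable_funTS.
by exists 1; split=> // M M1 x _ /=; rewrite (le_trans (g1 x))// ltW.
Qed.

Lemma integral_haar_shift c (A : set G) (g : G -> R) :
  measurable (A : set (borel G)) -> (lam A < +oo)%E ->
  measurable_fun setT (g : borel G -> R) -> (forall x, `|g x| <= 1) ->
  \int[lam]_(x in (A : set (borel G))) g (c + x) =
  \int[lam]_(x in ([set c + a | a in A] : set (borel G))) g x.
Proof.
move=> mA fA mg g1; have mcA := borel_shift_image c mA.
have mphi : measurable_fun setT ((fun x => c + x) : borel G -> borel G).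
  exact: borel_shift.
have preA : (fun x => c + x) @^-1` [set c + a | a in A] = A.
  by rewrite shift_preimage; apply/seteqP; split=> x /=; rewrite addKr.
have := @integral_pushforward _ _ (borel G) (borel G) R _ mphi lam
  ([set c + a | a in A]) (EFin \o g).
move=> /(_ _ _ mcA); rewrite preA /Rintegral => <-.
- congr fine; unshelve apply: eq_measure_integral => //.
  by move=> B mB _; exact: haar_shift_preimage.
- exact/measurable_EFinP.
- apply: (@bounded_finite_integrable A (fun x => g (c + x))) => //.
  exact: (measurableT_comp mg mphi).
Qed.

(** Inner regularity is given for open sets only, so [K] is chosen inside [U] and need not be
    contained in [A]. *)
Lemma haar_approx (A : set G) (e : R) : measurable (A : set (borel G)) ->
  (lam A < +oo)%E -> 0 < e ->
  exists U K : set G, [/\ open U, compact K, A `<=` U /\ K `<=` U,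
    (lam (U `\` A) <= e%:E)%E & (lam (U `\` K) <= e%:E)%E].
Proof.
move=> mA fA e0; have finA : lam A \is a fin_num by rewrite ge0_fin_numE.
have finI := finA; rewrite (haar_outer_regular hlam mA) in finI.
have [_ [U [oU AU] <-]] := lb_ereal_inf_adherent e0 finI.
rewrite -(haar_outer_regular hlam mA) => ltU.
have mU := @borel_open G U oU.
have fU : (lam U < +oo)%E by rewrite (lt_trans ltU)// lte_add_pinfty// ltry.
have finU : lam U \is a fin_num by rewrite ge0_fin_numE.
have finS := finU; rewrite (haar_inner_regular hlam oU) in finS.
have [_ [K [cK KU] <-]] := ub_ereal_sup_adherent e0 finS.
rewrite -(haar_inner_regular hlam oU) => ltK.
have mK := borel_compact hG cK.
exists U, K; split=> //.
- rewrite measureD//= (_ : _ `&` _ = A); last exact/setIidr.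
  by rewrite leeBlDr// addeC ltW.
- rewrite measureD//= (_ : _ `&` _ = K); last exact/setIidr.
  have fK : lam K \is a fin_num.
    by rewrite ge0_fin_numE// (le_lt_trans _ fU)// le_measure// inE.
  by rewrite leeBlDr// addeC -leeBlDr// ltW.
Qed.

Lemma haar_shiftD c (A : set G) : measurable (A : set (borel G)) ->
  (lam A < +oo)%E ->
  lam (A `\` [set c + a | a in A]) = lam ([set c + a | a in A] `\` A).
Proof.
move=> mA fA; have mcA := borel_shift_image c mA.
have EcA := haar_translation hlam c mA.
by rewrite !measureD//= ?EcA// setIC.
Qed.

(** For small [c], the translate of [K] by [c] stays in [U]. A point [c + a] outside [A], with [a]
    in [A], therefore lies in [U] minus [A] or comes from [A] minus [K], and both sets are small. *)
Lemma haar_shift_near (A : set G) (e : R) : measurable (A : set (borel G)) ->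
  (lam A < +oo)%E -> 0 < e ->
  \forall c \near (0 : G), (lam ([set (c + a)%R | a in A] `\` A) <= e%:E)%E.
Proof.
move=> mA fA e0; have e2 : 0 < e / 2 by rewrite divr_gt0.
have [U [K [oU cK [AU KU] UA UK]]] := haar_approx mA fA e2.
have mU := @borel_open G U oU; have mK := borel_compact hG cK.
apply: filterS (compact_shift_near cK oU KU) => c cKU.
have mcAK := borel_shift_image c (measurableD mA mK).
have sub : [set (c + a)%R | a in A] `\` A `<=`
    [set (c + a)%R | a in A `\` K] `|` (U `\` A).
  move=> _ [[a Aa <-] nA]; have [Ka|nK] := pselect (K a).
    by right; split=> //; exact: cKU.
  by left; exists a.
apply: (@le_trans _ _ (lam ([set (c + a)%R | a in A `\` K] `|` (U `\` A)))).
  apply: le_measure => //; rewrite inE; last first.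
    by apply: measurableU => //; exact: measurableD.
  by apply: measurableD => //; exact: borel_shift_image.
have le1 : (lam [set (c + a)%R | a in A `\` K] <= (e / 2)%:E)%E.
  rewrite (haar_translation hlam); last exact: measurableD.
  apply: le_trans UK; apply: le_measure; rewrite ?inE;
    [exact: measurableD | exact: measurableD | exact: setSD].
apply: (le_trans (measureU2 _ mcAK (measurableD mU mA))).
rewrite (splitr e) EFinD; exact: leeD.
Qed.

Lemma Rintegral_norm_le (A : set G) (g : G -> R) (r : R) :
  measurable (A : set (borel G)) -> (lam A <= r%:E)%E ->
  measurable_fun setT (g : borel G -> R) -> (forall x, `|g x| <= 1) ->
  `|\int[lam]_(x in (A : set (borel G))) g x| <= r.
Proof.
move=> mA Ar mg g1; have fA : (lam A < +oo)%E by rewrite (le_lt_trans Ar)// ltry.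
have ig := bounded_finite_integrable mA fA mg g1.
apply: (le_trans (le_normr_Rintegral mA ig)).
apply: (@le_trans _ _ (\int[lam]_(x in (A : set (borel G))) 1)).
  apply: le_Rintegral => //; first exact: (integrable_norm ig).
  apply: (@bounded_finite_integrable A (fun=> 1)) => // x; by rewrite normr1.
by rewrite Rintegral_cst// mul1r -lee_fin fineK// ge0_fin_numE.
Qed.

(** After a change of variable, [g] is integrated over [A] and over its translate. The common part
    cancels and the two differences have equal small measure. *)
Lemma integral_haar_shift_near (A : set G) (g : G -> R) (e : R) :
  measurable (A : set (borel G)) -> (lam A < +oo)%E -> 0 < e ->
  measurable_fun setT (g : borel G -> R) -> (forall x, `|g x| <= 1) ->
  \forall c \near (0 : G), `|\int[lam]_(x in (A : set (borel G))) g (c + x) -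
     \int[lam]_(x in (A : set (borel G))) g x| <= e.
Proof.
move=> mA fA e0 mg g1; have e2 : 0 < e / 2 by rewrite divr_gt0.
apply: filterS (haar_shift_near mA fA e2) => c cA.
have mcA := borel_shift_image c mA.
rewrite integral_haar_shift//; set cA_ := [set _ | _ in _] in cA mcA *.
have split_int (B C : set G) : measurable (B : set (borel G)) ->
    measurable (C : set (borel G)) -> (lam B < +oo)%E ->
    \int[lam]_(x in (B : set (borel G))) g x =
    \int[lam]_(x in (B `\` C : set (borel G))) g x +
    \int[lam]_(x in (B `&` C : set (borel G))) g x.
  move=> mB mC fB; have BE : (B `\` C) `|` (B `&` C) = B by rewrite setUC setUIDK.
  rewrite -[X in Rintegral _ X _ = _]BE Rintegral_setU//.
  - exact: measurableD.
  - exact: measurableI.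
  - by rewrite BE; exact: bounded_finite_integrable.
  - by apply/disj_set2P/seteqP; split=> x //= [[_ nC] [_ /nC]].
rewrite (split_int _ _ mA mcA fA) (split_int _ _ mcA mA); last first.
  by rewrite (haar_translation hlam).
rewrite [A `&` _]setIC opprD addrACA subrr addr0.
rewrite (splitr e) (le_trans (ler_normB _ _))// lerD// Rintegral_norm_le//;
  try exact: measurableD.
by rewrite haar_shiftD.
Qed.

End haar.

(** * Smearing and integrals over sets of finite measure *)

Section continuous_part_ae.
Context {R : realType} {G : topologicalZmodType}.
Variable lam : {measure set (borel G) -> \bar R}.
Hypothesis hG : hausdorff_space G.
Hypothesis hlam : haar_measure lam.

Lemma ae_seq (T : eqType) (t : seq T) (P : T -> set (borel G)) :
  (forall p, {ae lam, forall x, P p x}) ->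
  {ae lam, forall x, forall p, p \in t -> P p x}.
Proof.
move=> aeP; elim: t => [|p t IH]; first exact: nearW.
apply: filterS2 (aeP p) IH => x Pp Pt q.
by rewrite inE => /orP[/eqP ->|/Pt].
Qed.

Lemma ae_shift c (P : set (borel G)) : {ae lam, forall x, P x} ->
  {ae lam, forall x : borel G, P ((c : G) + x)}.
Proof.
move=> [N [mN N0 PN]]; exists ((fun x => c + x) @^-1` N); split.
- by rewrite -[X in measurable X]setTI; exact: borel_shift.
- by rewrite haar_shift_preimage.
- by move=> x /= nP; exact: PN.
Qed.

Lemma Rintegral_sum_seq (I : Type) (r : seq I) (A : set (borel G))
    (f : I -> G -> R) : measurable A ->
  (forall i, lam.-integrable A (EFin \o f i)) ->
  \int[lam]_(x in A) (\sum_(i <- r) f i x) =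
  \sum_(i <- r) \int[lam]_(x in A) f i x.
Proof.
move=> mA fi; rewrite /Rintegral.
under eq_integral do rewrite -sumEFin.
rewrite integral_sum// sum_fine// => i _.
by apply: integrable_fin_num => //; exact: fi.
Qed.

Lemma measurable_smear (g : G -> R) t : measurable_fun setT (g : borel G -> R) ->
  measurable_fun setT (smear g t : borel G -> R).
Proof.
move=> mg; have -> : smear g t =
    fun x => \sum_(p <- t) \sum_(q <- t) p.1 * q.1 * g (p.2 - q.2 + x).
  apply/funext => x; rewrite smearE; apply: eq_bigr => p _; apply: eq_bigr => q _.
  by rewrite -addrA addrC.
apply: measurable_sum => p; apply: measurable_sum => q.
by apply: measurable_funM => //; apply: (measurableT_comp mg); exact: borel_shift.
Qed.

(** The integral of [smear g t] is an average of integrals of translates of [g] by [p.2 - q.2], and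
    all these translations are small. *)
Lemma integral_smear_near (g : G -> R) (A : set (borel G)) (e : R) :
  measurable A -> (lam A < +oo)%E -> 0 < e ->
  measurable_fun setT (g : borel G -> R) -> (forall x, `|g x| <= 1) ->
  exists2 V, nbhs (0 : G) V & forall t, prob_in V t ->
    `|\int[lam]_(x in A) smear g t x - \int[lam]_(x in A) g x| <= e.
Proof.
move=> mA fA e0 mg g1.
have near0 := integral_haar_shift_near hG hlam mA fA e0 mg g1.
have [[V1 V2] /= [V10 V20] VB] : nbhs ((0 : G), (0 : G))
    [set z : G * G | `|\int[lam]_(x in A) g (z.1 - z.2 + x) -
        \int[lam]_(x in A) g x| <= e].
  have : z.1 - z.2 @[z --> ((0 : G), (0 : G))] --> (0 : G) - 0.
    exact: (@sub_continuous G (0, 0)).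
  by rewrite subrr => /(_ _ near0).
exists (V1 `&` V2); first exact: filterI.
move=> t tV.
have ig c : lam.-integrable A (EFin \o (fun x => g (c + x))).
  apply: bounded_finite_integrable => //.
  by apply: (measurableT_comp mg); exact: borel_shift.
have igM k c : lam.-integrable A (EFin \o (fun x => k * g (c + x))).
  exact: (integrableZl mA k (ig c)).
have -> : \int[lam]_(x in A) smear g t x = \sum_(p <- t) \sum_(q <- t)
    p.1 * q.1 * \int[lam]_(x in A) g (p.2 - q.2 + x).
  transitivity (\int[lam]_(x in A) \sum_(p <- t) \sum_(q <- t)
      p.1 * q.1 * g (p.2 - q.2 + x)).
    congr (Rintegral _ _ _); apply/funext => x.
    rewrite smearE; apply: eq_bigr => p _; apply: eq_bigr => q _.
    by rewrite -addrA addrC.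
  rewrite Rintegral_sum_seq//; last first.
    move=> p; have := @integrable_sum _ _ _ lam A mA _ t predT
      (fun q => EFin \o (fun x => p.1 * q.1 * g (p.2 - q.2 + x))).
    move=> /(_ (fun q _ => igM _ _)); apply: eq_integrable => // x _ /=.
    by rewrite sumEFin.
  apply: eq_bigr => p _; rewrite Rintegral_sum_seq//.
  by apply: eq_bigr => q _; rewrite RintegralZl.
set J := \int[lam]_(x in A) g x.
(* Both [J] and [e] become averages with the same weights, so that the comparison is termwise. *)
rewrite -(sum_weights J tV) -sumrB -(sum_weights e tV).
rewrite (le_trans (ler_norm_sum _ _ _))// !big_seq; apply: ler_sum => p pt.
rewrite -sumrB (le_trans (ler_norm_sum _ _ _))// !big_seq.
apply: ler_sum => q qt; have [p0 [Vp _]] := tV.1 p pt.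
have [q0 [_ Vq]] := tV.1 q qt.
rewrite -mulrBr normrM ger0_norm ?mulr_ge0//.
by apply: ler_wpM2l; [exact: mulr_ge0 | exact: (VB (p.2, q.2))].
Qed.

(** Measurability of [F] is not assumed, so integrals go through [g]. A smeared value involves
    finitely many translates only, hence [smear F t = smear g t] almost everywhere; the first is
    uniformly close to [Fc], and the second has almost the integral of [g]. *)
Lemma continuous_part_integral (F Fc g : G -> R) :
  measurable_fun setT (g : borel G -> R) -> (forall x, `|g x| <= 1) ->
  {ae lam, forall x, F x = g x} -> continuous Fc -> (forall x, `|Fc x| <= 1) ->
  (forall e V, 0 < e -> nbhs (0 : G) V ->
      exists2 t, prob_in V t & forall x, `|Fc x - smear F t x| <= e) ->
  forall A : set (borel G), measurable A -> (lam A < +oo)%E ->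
    \int[lam]_(x in A) Fc x = \int[lam]_(x in A) g x.
Proof.
move=> mg g1 Fg cFc Fc1 FcF A mA fA; apply/eqP; rewrite -subr_eq0 -normr_le0.
have mFc := borel_continuous cFc.
have finA : lam A \is a fin_num by rewrite ge0_fin_numE.
(* The added [1] keeps [L] positive when [A] is null. *)
pose L := fine (lam A) + 1; have L0 : 0 < L by rewrite ltr_pwDr// fine_ge0.
apply/ler_addgt0Pl => e e0; rewrite addr0.
have e2 : 0 < e / 2 by rewrite divr_gt0.
have eL : 0 < e / 2 / L by rewrite divr_gt0.
have [V V0 HV] := integral_smear_near mA fA e2 mg g1.
have [t tV Ht] := FcF _ _ eL V0.
have ms := measurable_smear t mg.
have s1 x : `|smear g t x| <= 1.
  rewrite ler_norml (smear_ge tV)?(smear_le tV)// => a b _ _;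
  by have := g1 (x + a - b); rewrite ler_norml => /andP[].
have iF := bounded_finite_integrable mA fA mFc Fc1.
have is_ := bounded_finite_integrable mA fA ms s1.
rewrite -(subrKA (\int[lam]_(x in A) smear g t x)) (splitr e).
rewrite (le_trans (ler_normD _ _))// lerD ?HV//.
have aeFs : {ae lam, forall x, smear F t x = smear g t x}.
  have H (p q : R * G) : {ae lam, forall x, F (x + p.2 - q.2) = g (x + p.2 - q.2)}.
    have := @ae_shift (p.2 - q.2) _ Fg; apply: filterS => x.
    by have -> : x + p.2 - q.2 = p.2 - q.2 + x by rewrite -addrA addrC.
  have := ae_seq t (fun p => ae_seq t (H p)); apply: filterS => x Hx.
  rewrite !smearE !big_seq; apply: eq_bigr => p pt.
  by rewrite !big_seq; apply: eq_bigr => q qt; rewrite Hx.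
rewrite -RintegralB//.
have mB : measurable_fun setT ((fun x => Fc x - smear g t x) : borel G -> R).
  exact: measurable_funB.
have iB : lam.-integrable A (EFin \o (fun x => Fc x - smear g t x)).
  exact: (integrableB mA iF is_).
apply: (le_trans (le_normr_Rintegral mA iB)).
have aeb : {ae lam, forall x : G, A x ->
    (`|(Fc x - smear g t x)%:E| <= (e / 2 / L)%:E)%E}.
  have [N [mN N0 sN]] := aeFs; exists N; split=> // x /= nle; apply: sN => /= eFg.
  by apply: nle => _; rewrite -eFg lee_fin; exact: Ht.
have leL : (\int[lam]_(x in A) `|(Fc x - smear g t x)%:E| <=
    (e / 2 / L)%:E * lam A)%E.
  apply: integral_le_bound => //.
  - by apply/measurable_EFinP; exact: measurable_funTS.
  - by rewrite lee_fin ltW.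
rewrite -lee_fin /Rintegral fineK; last first.
  by apply: integrable_fin_num => //; exact: (integrable_norm iB).
apply: (le_trans leL); rewrite -(fineK finA) -EFinM lee_fin.
by rewrite mulrAC ler_pdivrMr// ler_pM2l// /L lerDl.
Qed.

End continuous_part_ae.

(** * Fatou's lemma with an upper bound only *)

Lemma integrable_indic_finite {d} {T : measurableType d} {R : realType}
    (mu : {measure set T -> \bar R}) (B : set T) :
  measurable B -> (mu B < +oo)%E -> mu.-integrable setT (EFin \o \1_B).
Proof.
move=> mB fB; apply/integrableP; split; first exact/measurable_EFinP.
under eq_integral do rewrite /= ger0_norm//.
by rewrite integral_indic// setIT.
Qed.

(** The functions [f n] are dominated from above only. Fatou's lemma for [h n = \1_B - f n] bounds
    the integral of [k = \1_B - g] by [mu B - s], which gives both the integrability of [g] and the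
    inequality. *)
Lemma fatou_dominated {d} {T : measurableType d} {R : realType}
    (mu : {measure set T -> \bar R}) (f : nat -> T -> R) (g : T -> R)
    (B N : set T) (s : R) :
  measurable B -> (mu B < +oo)%E -> measurable N -> mu N = 0%E ->
  (forall n, mu.-integrable setT (EFin \o f n)) ->
  measurable_fun setT g ->
  (forall n x, f n x <= \1_B x) -> (forall x, g x <= \1_B x) ->
  (forall x, ~ N x -> f n x @[n --> \oo] --> g x) ->
  (forall e, 0 < e -> \forall n \near \oo, s - e <= \int[mu]_x f n x) ->
  mu.-integrable setT (EFin \o g) /\ s <= \int[mu]_x g x.
Proof.
move=> mB fB mN N0 fi mg fB1 gB1 fg sf.
have finB : mu B \is a fin_num by rewrite ge0_fin_numE.
have mf n : measurable_fun setT (f n).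
  exact/measurable_EFinP/(measurable_int _ (fi n)).
have iB := integrable_indic_finite mB fB.
have IB : \int[mu]_x \1_B x = fine (mu B).
  by rewrite /Rintegral integral_indic// setIT.
pose h n x := \1_B x - f n x; pose k x := \1_B x - g x.
have h0 n x : 0 <= h n x by rewrite subr_ge0.
have k0 x : 0 <= k x by rewrite subr_ge0.
have mh n : measurable_fun setT (h n) by exact: measurable_funB.
have mk : measurable_fun setT k by exact: measurable_funB.
have ih n : mu.-integrable setT (EFin \o h n).
  exact: (integrableB measurableT iB (fi n)).
have Ih n : (\int[mu]_x (h n x)%:E = (fine (mu B) - \int[mu]_x f n x)%:E)%E.
  rewrite -IB -RintegralB// /Rintegral fineK//.
  exact: (integrable_fin_num measurableT (ih n)).
have le_k : (\int[mu]_x (k x)%:E <= (fine (mu B) - s)%:E)%E.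
  have mEk : measurable_fun setT (EFin \o k) by exact/measurable_EFinP.
  have Ek0 x : setT x -> (0 <= (EFin \o k) x)%E by rewrite lee_fin.
  rewrite (ge0_negligible_integral mN measurableT mEk Ek0 N0).
  rewrite setTD (eq_integral (fun x => limn_einf (fun n => (h n x)%:E))); last first.
    move=> x /set_mem nNx; apply/esym; apply: (cvg_limn_einf_sup _).1.
    by apply: cvg_EFin; [exact: nearW | apply: cvgB; [exact: cvg_cst | exact: fg]].
  apply: (@le_trans _ _ (limn_einf (fun n => \int[mu]_(x in ~` N) (h n x)%:E)))%E.
    apply: fatou => //; first exact: measurableC.
      by move=> n; apply/measurable_EFinP; exact: measurable_funTS.
    by move=> n x _; rewrite lee_fin.
  apply/lee_addgt0Pr => e e0; rewrite -EFinD limn_einf_lim.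
  apply: lime_le; first exact: is_cvg_einfs.
  (* The infimum of the tail from [n] is at most its term at an index [i] beyond [m]. *)
  apply: nearW => n; have [m _ Hm] := sf _ e0.
  have [/= i ni] : exists i, (n <= i)%N /\ (m <= i)%N.
    by exists (maxn n m); rewrite leq_maxl leq_maxr.
  apply: ge_ereal_inf.
  exists (\int[mu]_(x in ~` N) (h i x)%:E)%E; first by exists i => //=; exact: ni.1.
  apply: (@le_trans _ _ (\int[mu]_x (h i x)%:E)%E).
    apply: ge0_subset_integral => //; first exact: measurableC.
      exact/measurable_EFinP.
    by move=> x _; rewrite lee_fin.
  rewrite Ih lee_fin; have := Hm i ni.2; rewrite /=; lra.
have ik : mu.-integrable setT (EFin \o k).
  apply/integrableP; split; first exact/measurable_EFinP.
  under eq_integral do rewrite /= ger0_norm//.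
  by rewrite (le_lt_trans le_k)// ltry.
have gE : g = fun x => \1_B x - k x by apply/funext => x; rewrite /k subKr.
split; first by rewrite gE; exact: (integrableB measurableT iB ik).
rewrite [in leRHS]gE RintegralB// IB.
have : \int[mu]_x k x <= fine (mu B) - s.
  by rewrite -lee_fin /Rintegral fineK//; exact: (integrable_fin_num measurableT ik).
lra.
Qed.

(** * Integrability of the continuous version *)

Section continuous_version.
Context {R : realType} {G : topologicalZmodType}.
Variable lam : {measure set (borel G) -> \bar R}.
Hypothesis hG : hausdorff_space G.
Hypothesis hlam : haar_measure lam.

(** Equal integrals force [h = g] almost everywhere on each set of finite measure. As [G] need not
    be sigma-finite, this is globalized by covering the points where [g] or [h] is nonzero by
    countably many sets [P n] and [O n] of finite measure. *)
Lemma continuous_version (g h : G -> R) :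
  measurable_fun setT (g : borel G -> R) -> (forall x, `|g x| <= 1) ->
  lam.-integrable [set: borel G] (EFin \o g) ->
  continuous h -> (forall x, `|h x| <= 1) ->
  (forall A : set (borel G), measurable A -> (lam A < +oo)%E ->
    \int[lam]_(x in A) h x = \int[lam]_(x in A) g x) ->
  lam.-integrable [set: borel G] (EFin \o h) /\
  \int[lam]_x h x = \int[lam]_x g x.
Proof.
move=> mg g1 ig ch h1 hg; have mh := borel_continuous ch.
have ae_fin (A : set (borel G)) : measurable A -> (lam A < +oo)%E ->
    ae_eq lam A (EFin \o h) (EFin \o g).
  move=> mA fA; apply: integral_ae_eq => //.
  - exact: bounded_finite_integrable.
  - by apply/measurable_EFinP; exact: measurable_funTS.
  - move=> E EA mE; have fE : (lam E < +oo)%E.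
      by rewrite (le_lt_trans _ fA)// le_measure// inE.
    have Ih := integrable_fin_num mE (bounded_finite_integrable mE fE mh h1).
    have Ig := integrable_fin_num mE (bounded_finite_integrable mE fE mg g1).
    by rewrite -[LHS](fineK Ih) -[RHS](fineK Ig); congr (_%:E); exact: hg.
pose J := (\int[lam]_x `|(g x)%:E|)%E.
have J_lty : (J < +oo)%E by have /integrableP[] := ig.
have mag : measurable_fun setT ((fun x => `|(g x)%:E|%E) : borel G -> \bar R).
  by apply: measurableT_comp => //; exact/measurable_EFinP.
pose P n : set (borel G) := [set x | n.+1%:R^-1 <= `|g x|].
pose O n : set (borel G) := [set x | n.+1%:R^-1 < `|h x|].
have mP n : measurable (P n).
  rewrite -[P n]setTI; apply: measurable_fun_le => //.
  exact: measurableT_comp.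
have oO n : open (O n : set G).
  have -> : O n = (fun x => `|h x|) @^-1` [set y | n.+1%:R^-1 < y] by [].
  apply: open_comp; last exact: open_gt.
  by move=> x _; apply: continuous_comp; [exact: ch | exact: norm_continuous].
have fin_P n : (lam (P n) < +oo)%E.
  have n0 : 0 < n.+1%:R^-1 :> R by rewrite invr_gt0.
  have := le_integral_abse lam measurableT
    (measurable_int lam ig) n0; rewrite setTI => le1.
  have : ((n.+1%:R^-1)%:E * lam (P n) < +oo)%E.
    by apply: le_lt_trans J_lty; exact: le1.
  move=> lty; rewrite ltNge leye_eq; apply/negP => /eqP Ey; move: lty.
  by rewrite Ey gt0_muley ?lte_fin// ltxx.
(* The integrability of [h] is not yet known. But [O n] is open, and on a compact subset [K] of it
   [h = g] almost everywhere, so Markov's inequality on [K] and inner regularity bound [lam (O n)]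
   by [n.+1 * J]. *)
have fin_O n : (lam (O n) < +oo)%E.
  have n0 : 0 < n.+1%:R^-1 :> R by rewrite invr_gt0.
  suff : (lam (O n) <= n.+1%:R%:E * J)%E.
    by move=> /le_lt_trans; apply; rewrite lte_mul_pinfty.
  rewrite (haar_inner_regular hlam (oO n)); apply: ge_ereal_sup => _ [K [cK KO] <-].
  have mK := borel_compact hG cK; have fK := haar_compact_fin hlam cK.
  rewrite -(@lee_pmul2l _ (n.+1%:R^-1)%:E)// ?lte_fin//.
  rewrite muleA -EFinM mulVf// mul1e.
  apply: (@le_trans _ _ (\int[lam]_(x in (K : set (borel G))) `|(h x)%:E|)%E).
    rewrite -integral_cst//; apply: ge0_le_integral => //.
    - by move=> x _; rewrite lee_fin ltW.
    - by apply: measurableT_comp => //; apply/measurable_EFinP; exact: measurable_funTS.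
    - by move=> x Kx; rewrite lee_fin ltW//; exact: KO.
  rewrite (@ge0_ae_eq_integral _ _ _ lam K _ (fun x => `|(g x)%:E|%E))//.
  - by apply: ge0_subset_integral.
  - by apply: measurableT_comp => //; apply/measurable_EFinP; exact: measurable_funTS.
  - exact: measurable_funTS.
  - have [M [mM M0 sM]] := ae_fin K mK fK; exists M; split=> // x /= nx.
    by apply: sM => /= ex; apply: nx => Kx; have /= [->] := ex Kx.
have aehg : ae_eq lam setT (EFin \o h) (EFin \o g).
  have mO n := @borel_open G _ (oO n).
  have aen n : {ae lam, forall x, (P n `|` O n) x -> (EFin \o h) x = (EFin \o g) x}.
    apply: ae_fin; first exact: measurableU.
    apply: (le_lt_trans (measureU2 _ (mP n) (mO n))).
    exact: (lte_add_pinfty (fin_P n) (fin_O n)).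
  have [M [mM M0 sM]] := ae_foralln aen; exists M; split=> // x /= nx.
  apply: sM => /= H; apply: nx => _.
  have [n Hn] : exists n, h x != g x -> (P n `|` O n) x.
    have [hgx|hgx] := eqVneq (h x) (g x); first by exists 0%N.
    have : 0 < `|g x| \/ 0 < `|h x|.
      rewrite !normr_gt0; case: (eqVneq (g x) 0) => [gx|]; last by left.
      by right; rewrite -gx.
    case=> p0; have [n ltn] := ltr_add_invr p0; rewrite add0r in ltn; exists n => _;
      by [left; rewrite /P/= ltW | right].
  have [hgx|/Hn/H//] := eqVneq (h x) (g x); by rewrite hgx.
have mEg : measurable_fun setT (EFin \o g : borel G -> \bar R).
  exact/measurable_EFinP.
have mEh : measurable_fun setT (EFin \o h : borel G -> \bar R).
  exact/measurable_EFinP.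
have Ehg : (\int[lam]_x (h x)%:E = \int[lam]_x (g x)%:E)%E.
  exact: (@ae_eq_integral _ (borel G) R lam setT (EFin \o g) (EFin \o h)
    measurableT mEh mEg aehg).
split; last by rewrite /Rintegral Ehg.
apply/integrableP; split=> //.
rewrite (@ge0_ae_eq_integral _ _ _ lam setT _ (fun x => `|(g x)%:E|%E))//.
- exact: measurableT_comp.
- have [M [mM M0 sM]] := aehg; exists M; split=> // x /= nx.
  by apply: sM => /= ex; apply: nx => _; have /= [->] := ex I.
Qed.

End continuous_version.

(** * A function of the class with positive integral *)

Section haar_open.
Context {R : realType} {G : topologicalZmodType}.
Variable lam : {measure set (borel G) -> \bar R}.
Hypothesis hG : hausdorff_space G.
Hypothesis hlam : haar_measure lam.

(** If [O] were null, every point would have a null neighbourhood, a translate of [O]; compact sets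
    would then be null, and by inner regularity so would [G]. *)
Lemma haar_open_neq0 (O : set G) : open O -> O !=set0 -> lam O <> 0%E.
Proof.
move=> oO [x Ox] O0; apply: (haar_neq0 hlam).
rewrite (haar_inner_regular hlam openT).
apply/eqP; rewrite eq_le; apply/andP; split; last first.
  by apply: ereal_sup_ubound; exists set0 => //; split=> //; exact: compact0.
apply: ge_ereal_sup => _ [K [cK _] <-].
have mK := borel_compact hG cK.
rewrite leNgt; apply/negP => K0.
(* The complements of null sets, traced on [K], form a proper filter; its
   cluster point has a null neighbourhood. *)
pose Phi : set_system G := fun A =>
  exists M : set (borel G), [/\ measurable M, lam M = 0%E & K `\` M `<=` A].
have PF : ProperFilter Phi.
  split=> [[M [mM M0 KM]]|].
    suff : (lam K <= lam M)%E by rewrite M0 leNgt K0.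
    apply: le_measure; rewrite ?inE// => z Kz; have [//|nMz] := pselect (M z).
    by have := KM z (conj Kz nMz).
  split; first by exists set0; split=> //; rewrite measure0.
    move=> A B [M [mM M0 KA]] [N [mN N0 KB]]; exists (M `|` N); split.
    - exact: measurableU.
    - have : (lam (M `|` N) <= lam M + lam N)%E by exact: measureU2.
      by rewrite M0 N0 adde0 measure_le0 => /eqP.
    - by move=> z [Kz nMN]; split; [apply: KA | apply: KB]; split=> // ?;
        apply: nMN; [left | right].
  by move=> A B AB [M [mM M0 KA]]; exists M; split=> //; exact: subset_trans KA AB.
have [p [Kp clp]] : K `&` cluster Phi !=set0.
  by apply: cK; exists set0; split; [|exact: measure0|move=> z []].
pose M : set (borel G) := (fun z => x - p + z) @^-1` O.
have mO := @borel_open G O oO.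
have mM : measurable M by rewrite -[M]setTI; exact: borel_shift.
have Mp : nbhs (p : G) M.
  apply: open_nbhs_nbhs; split; last by rewrite /M /= subrK.
  apply: open_comp => // z _.
  by apply: group_cvgD; [exact: cvg_cst | exact: cvg_id].
have [|z [nMz Mz]] := clp (~` M) M _ Mp; last exact: nMz.
by exists M; split; [|rewrite -O0; exact: haar_shift_preimage|move=> z []].
Qed.

Lemma integral_continuous_gt0 (f : G -> R) : continuous f ->
  lam.-integrable [set: borel G] (EFin \o f) ->
  (forall x, 0 <= f x) -> f 0 = 1 -> 0 < \int[lam]_x f x.
Proof.
move=> cf fi f0 f01; have mf := borel_continuous cf.
pose O : set G := [set x | 2^-1 < f x].
have oO : open O.
  have -> : O = f @^-1` [set y | 2^-1 < y] by [].
  by apply: open_comp; [move=> x _; exact: cf | exact: open_gt].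
have O0 : O !=set0 by exists 0; rewrite /O /= f01; lra.
have := haar_open_neq0 oO O0; have mO := @borel_open G O oO.
have le1 : ((2^-1)%:E * lam O <= \int[lam]_x (f x)%:E)%E.
  rewrite -integral_cst//.
  apply: (@le_trans _ _ (\int[lam]_(x in (O : set (borel G))) (f x)%:E)%E).
    apply: ge0_le_integral => //.
    - by move=> x _; rewrite lee_fin.
    - by apply/measurable_EFinP; exact: measurable_funTS.
    - by move=> x Ox; rewrite lee_fin ltW.
  apply: ge0_subset_integral => //; first exact/measurable_EFinP.
  by move=> x _; rewrite lee_fin.
move=> On0; rewrite -lte_fin /Rintegral fineK; last exact: integrable_fin_num.
apply: lt_le_trans le1; rewrite mule_gt0// ?lte_fin ?invr_gt0//.
by rewrite lt_neqAle measure_ge0 andbT eq_sym; exact/eqP.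
Qed.

(* The normalised autocorrelation [lam (U `&` (x + U)) / lam U] of a small
   open set [U]. *)
Lemma autocorrelation (W : set G) : locally_compact [set: G] ->
  nbhs (0 : G) W ->
  exists f : G -> R, [/\ real_positive_definite f, continuous f, f 0 = 1,
    (forall x, 0 <= f x) & (forall x, 0 < f x -> W x)].
Proof.
move=> lcG W0.
have [C C0 cC] : exists2 C : set G, nbhs 0 C & compact C.
  have [C C0 [cC _]] := lcG 0 I.
  exists C => //; have C1 : \forall x \near (0 : G), setT x -> C x := C0.
  by apply: filterS C1 => x; exact.
have [[V1 V2] /= [V10 V20] VW] : nbhs ((0 : G), (0 : G))
    [set z : G * G | W (z.1 - z.2)].
  have : z.1 - z.2 @[z --> ((0 : G), (0 : G))] --> (0 : G) - 0.
    exact: (@sub_continuous G (0, 0)).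
  by rewrite subrr => /(_ _ W0).
(* Being inside [C] makes the measure of [U] finite; being inside [V1] and [V2] puts all differences
   of points of [U] in [W]. *)
pose U : set G := (C `&` (V1 `&` V2))°.
have oU : open U by exact: open_interior.
have U00 : U 0 by apply: filterI => //; exact: filterI.
have UC : U `<=` C `&` (V1 `&` V2) by exact: interior_subset.
have mU := @borel_open G U oU.
have fU : (lam U < +oo)%E.
  apply: le_lt_trans (haar_compact_fin hlam cC); apply: le_measure;
    rewrite ?inE//; [exact: borel_compact | by move=> x /UC[]].
pose T c : set (borel G) := (fun x => c + x) @^-1` U.
have mT c : measurable (T c).
  by rewrite -[X in measurable X]setTI; exact: borel_shift.
have lT c : lam (T c) = lam U by exact: (haar_shift_preimage hlam).
have fT c : (lam (T c) < +oo)%E by rewrite lT.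
have fTI c c' : (lam (T c `&` T c') < +oo)%E.
  by apply: le_lt_trans (fT c); apply: le_measure; rewrite ?inE//; exact: measurableI.
have finTI c c' : lam (T c `&` T c') \is a fin_num.
  by rewrite ge0_fin_numE.
pose r0 := fine (lam U).
have r00 : 0 < r0.
  rewrite fine_gt0// fU andbT lt_neqAle measure_ge0 andbT eq_sym.
  by apply/eqP; apply: haar_open_neq0 => //; exists 0.
pose r x := fine (lam (T 0 `&` T x)).
have rE c x : r x = fine (lam (T c `&` T (c + x))).
  rewrite /r -(haar_shift_preimage hlam c (measurableI _ _ (mT 0) (mT x))).
  congr (fine (lam _)); rewrite /T; apply/seteqP; split=> y /=;
    by rewrite add0r addrA (addrC x).
have r_ge0 x : 0 <= r x by exact: fine_ge0.
have evr x : r (- x) = r x by rewrite (rE x) addrN setIC /r.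
have pr : real_positive_definite r.
  split=> // s.
  (* By invariance [r (p.2 - q.2)] is the measure of the intersection of [T (- p.2)] and
     [T (- q.2)], so the form is the integral of the square of [\sum_p p.1 * \1_(T (- p.2))]. *)
  pose e (p q : R * G) x : R := p.1 * q.1 * \1_(T (- p.2) `&` T (- q.2)) x.
  have iT c c' :=
    integrable_indic_finite (measurableI _ _ (mT c) (mT c')) (fTI c c').
  have ie p q : lam.-integrable [set: borel G] (EFin \o e p q).
    exact: (integrableZl measurableT (p.1 * q.1) (iT (- p.2) (- q.2))).
  have -> : gram r s s = \int[lam]_x \sum_(p <- s) \sum_(q <- s) e p q x.
    rewrite (Rintegral_sum_seq s measurableT); last first.
      move=> p; have := @integrable_sum _ _ _ lam _ measurableT _ s predT
        (fun q => EFin \o e p q).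
      move=> /(_ (fun q _ => ie _ _)); apply: eq_integrable => // x _ /=.
      by rewrite sumEFin.
    apply: eq_bigr => p _.
    rewrite (Rintegral_sum_seq s measurableT (ie p)).
    apply: eq_bigr => q _; rewrite (RintegralZl _ measurableT (iT _ _)).
    rewrite /Rintegral integral_indic ?setIT//; last exact: measurableI.
    by rewrite (rE (- p.2)) addrA addNr add0r.
  apply: Rintegral_ge0 => x _.
  pose k (p : R * G) : R := p.1 * \1_(T (- p.2)) x.
  have -> : \sum_(p <- s) \sum_(q <- s) e p q x = (\sum_(p <- s) k p) ^+ 2.
    rewrite expr2 mulr_suml; apply: eq_bigr => p _.
    rewrite mulr_sumr; apply: eq_bigr => q _.
    by rewrite /e /k indicI/=; ring.
  exact: sqr_ge0.
have cr : continuous r.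
  (* The difference [r x - r y] is at most the measure of [T x] minus [T y], which a translation
     carries into the set in the hypothesis. *)
  have r_lip x y e : (lam ([set (y - x + a)%R | a in U] `\` U) <= e%:E)%E ->
      r x - r y <= e.
    move=> le_e; rewrite lerBlDl -lee_fin EFinD /r !fineK//.
    have sub : T 0 `&` T x `<=` (T 0 `&` T y) `|` (T x `\` T y).
      by move=> z [T0z Txz]; have [Tyz|nTyz] := pselect (T y z); [left | right].
    have mD : measurable (T x `\` T y) by exact: measurableD.
    have mI : measurable (T 0 `&` T y) by exact: measurableI.
    apply: (@le_trans _ _ (lam ((T 0 `&` T y) `|` (T x `\` T y)))).
      by apply: le_measure; rewrite ?inE//; [exact: measurableI | exact: measurableU].
    apply: (le_trans (measureU2 _ mI mD)); apply: leeD => //.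
    apply: le_trans le_e.
    have mS := measurableD (borel_shift_image (y - x) mU) mU.
    rewrite -(haar_shift_preimage hlam y mS) shift_preimage.
    apply: le_measure; rewrite ?inE//.
      rewrite -[X in measurable X]setTI -shift_preimage; exact: borel_shift.
    by move=> z [Txz nTyz]; split=> //; rewrite /= opprB addrA subrK.
  move=> x; apply/cvgrPdist_le => e e0.
  have n0 := haar_shift_near hG hlam mU fU e0.
  have cy : y - x @[y --> x] --> x - x.
    by apply: group_cvgB; [exact: cvg_id | exact: cvg_cst].
  have cx : x - y @[y --> x] --> x - x.
    by apply: group_cvgB; [exact: cvg_cst | exact: cvg_id].
  rewrite subrr in cx cy.
  have {cy}n1 : \forall y \near x,
    (lam ([set (y - x + a)%R | a in U] `\` U) <= e%:E)%E := cy _ n0.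
  have {cx}n2 : \forall y \near x,
    (lam ([set (x - y + a)%R | a in U] `\` U) <= e%:E)%E := cx _ n0.
  apply: filterS2 n1 n2 => y h1 h2.
  by rewrite ler_norml (r_lip _ _ _ h1) andbT -opprB lerN2 (r_lip _ _ _ h2).
exists (fun x => r x / r0); split.
- under eq_fun do rewrite mulrC; apply: posdef_scale => //.
  by rewrite invr_ge0 ltW.
- by move=> x; apply: cvgM; [exact: cr | exact: cvg_cst].
- rewrite /r setIid.
  have -> : T 0 = U by apply/seteqP; split=> y; rewrite /T/= add0r.
  by rewrite divff// gt_eqF.
- by move=> x; rewrite divr_ge0// ltW.
move=> x; rewrite pmulr_lgt0 ?invr_gt0// => rx.
have [y [/= Uy Uxy]] : T 0 `&` T x !=set0.
  apply/set0P/negP => /eqP T0; move: rx; rewrite /r T0 measure0 /= ltxx.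
  by [].
have := VW (x + y, y); rewrite /= addrK; apply; split=> /=.
  by have [_ []] := UC _ Uxy.
by move: Uy; rewrite /T /= add0r => /UC[_ []].
Qed.

End haar_open.

(** * Maximizing sequences *)

(** The weighted sum [H] of the terms [2 ^+ n * (f n.+1 x - f n x) ^+ 2] has integral at most
    [2 * c], hence is finite off a null set. There the increments are absolutely summable, by the
    inequality between arithmetic and geometric means ([uE]). *)
Lemma ae_cvg_of_fast_L2 {d} {T : measurableType d} {R : realType}
    (mu : {measure set T -> \bar R}) (f : nat -> T -> R) (c : R) :
  (forall n, measurable_fun setT (f n)) ->
  (forall n, (\int[mu]_x ((f n.+1 x - f n x) ^+ 2)%:E <= (c / 4 ^+ n)%:E)%E) ->
  exists N : set T, [/\ measurable N, mu N = 0%E &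
    forall x, ~ N x -> cvgn (f ^~ x)].
Proof.
move=> mf fc.
pose h n x : R := 2 ^+ n * (f n.+1 x - f n x) ^+ 2.
have h0 n x : 0 <= h n x by apply: mulr_ge0; [exact: exprn_ge0 | exact: sqr_ge0].
have md n : measurable_fun setT (fun x => (f n.+1 x - f n x) ^+ 2).
  by apply: measurable_funX; exact: measurable_funB.
have mh n : measurable_fun setT (EFin \o h n).
  by apply/measurable_EFinP; exact: measurable_funM.
pose H x := (\sum_(n <oo) (h n x)%:E)%E.
have mH : measurable_fun setT H.
  have := @ge0_emeasurable_sum _ T R setT (fun k x => (h k x)%:E) xpredT.
  by apply=> [n x _ _|n _]; [rewrite lee_fin | exact: mh].
have H0 x : (0 <= H x)%E by apply: nneseries_ge0 => n _ _; rewrite lee_fin.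
have Ih n : (\int[mu]_x (h n x)%:E <= (c / 2 ^+ n)%:E)%E.
  under eq_integral do rewrite /h EFinM.
  have md' : measurable_fun setT (fun x => ((f n.+1 x - f n x) ^+ 2)%:E).
    exact/measurable_EFinP.
  rewrite (ge0_integralZl mu measurableT md'); last 2 first.
  - by move=> x _; rewrite lee_fin sqr_ge0.
  - by rewrite lee_fin exprn_ge0.
  apply: (@le_trans _ _ ((2 ^+ n)%:E * (c / 4 ^+ n)%:E)%E).
    by apply: lee_wpmul2l => //; rewrite lee_fin exprn_ge0.
  rewrite -EFinM lee_fin (_ : 4 = 2 * 2)%R; last by ring.
  by rewrite exprMn le_eqVlt; apply/orP; left; apply/eqP; field; rewrite expf_neq0.
have c0 : 0 <= c.
  have := Ih 0%N; rewrite expr0 divr1 -lee_fin; apply: le_trans.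
  by apply: integral_ge0 => x _; rewrite lee_fin.
have HI : (\int[mu]_x H x < +oo)%E.
  apply: (@le_lt_trans _ _ (c * 2)%:E); last exact: ltry.
  rewrite integral_nneseries//; last by move=> n x _; rewrite lee_fin.
  apply: lime_le.
    by apply: is_cvg_nneseries => n _ _; apply: integral_ge0 => x _; rewrite lee_fin.
  apply: nearW => n.
  apply: (@le_trans _ _ (\sum_(0 <= k < n) (c / 2 ^+ k)%:E)%E).
    exact: lee_sum.
  rewrite sumEFin lee_fin.
  have -> : \sum_(0 <= k < n) c / 2 ^+ k = c * 2 - c * 2 / 2 ^+ n.
    elim: n => [|n IH]; first by rewrite big_geq// expr0 divr1 subrr.
    rewrite big_nat_recr//= IH exprS; field; exact: expf_neq0.
  by rewrite gerBl divr_ge0 ?mulr_ge0 ?exprn_ge0.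
have iH : mu.-integrable setT H.
  apply/integrableP; split=> //.
  by under eq_integral do rewrite gee0_abs//.
have [N [mN N0 sN]] := integrable_ae measurableT iH.
exists N; split=> // x nNx.
have finH : H x \is a fin_num.
  by apply: contrapT => nf; apply: nNx; apply: sN => /= /(_ I).
pose u n : R := telescope (f ^~ x) n.
have uE n : `|u n| <= 2^-1 * (2^-1 ^+ n + h n x).
  have p2 : 0 < 2 ^+ n :> R by exact: exprn_gt0.
  have -> : 2^-1 ^+ n = (2 ^+ n)^-1 :> R by rewrite exprVn.
  rewrite /h -/(u n); move: (2 ^+ n) p2 => a a0.
  rewrite -(real_normK (num_real (f n.+1 x - f n x))) /u /telescope /=.
  move: `|_| => v; rewrite -subr_ge0.
  have -> : 2^-1 * (a^-1 + a * v ^+ 2) - v = 2^-1 * a^-1 * (a * v - 1) ^+ 2.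
    by field; rewrite gt_eqF.
  by rewrite mulr_ge0 ?sqr_ge0// mulr_ge0 ?invr_ge0// ltW.
have cs : cvgn (series u).
  apply: normed_cvg; apply: nondecreasing_is_cvgn.
    by apply: nondecreasing_series => n _ _; exact: normr_ge0.
  exists (2^-1 * (2 + fine (H x))) => _ [n _ <-].
  apply: (@le_trans _ _ (\sum_(0 <= k < n) 2^-1 * (2^-1 ^+ k + h k x))).
    by apply: ler_sum => k _; exact: uE.
  rewrite -mulr_sumr big_split /=; apply: ler_wpM2l; first by rewrite invr_ge0.
  apply: lerD.
    have -> : \sum_(0 <= k < n) 2^-1 ^+ k = 2 - 2 * 2^-1 ^+ n :> R.
      elim: n => [|n IH]; first by rewrite big_geq// expr0 mulr1 subrr.
      by rewrite big_nat_recr//= IH exprS; field.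
    by rewrite gerBl mulr_ge0// exprn_ge0// invr_ge0.
  rewrite -lee_fin fineK// -sumEFin.
  apply: nneseries_lim_ge => k _ _; by rewrite lee_fin.
have -> : f ^~ x = fun n => f 0%N x + series u n.
  by apply/funext => n; exact: (eq_sum_telescope (f ^~ x)).
by apply: is_cvgD => //; exact: is_cvg_cst.
Qed.

(* The limit has to exist at every point, not just almost everywhere, for
   positive definiteness to pass to it. *)
Lemma ultralimit {T : Type} {R : realType} (f : nat -> T -> R) :
  (forall n x, `|f n x| <= 1) ->
  exists (U : set_system nat) (F : T -> R), [/\ ProperFilter U,
    forall A, \oo A -> U A & forall x, f ^~ x @ U --> F x].
Proof.
move=> f1; have [U [UU ooU]] := ultraFilterLemma (eventually_filter).
have ex x : exists l : R, f ^~ x @ U --> l.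
  have cK : compact [set` `[(-1 : R), 1]] by exact: segment_compact.
  have PU : ProperFilter U := @ultra_proper _ _ UU.
  have Ux : U (f ^~ x @^-1` [set` `[(-1 : R), 1]]).
    by apply: filterE => n; rewrite /= in_itv /= -ler_norml.
  have [l [_ cl]] := cK (f ^~ x @ U) _ Ux.
  exists l => V lV.
  have [//|nV] := in_ultra_setVsetC (f ^~ x @^-1` V) UU.
  by have [z [nVz /nVz]] := cl (~` V) V nV lV.
exists U, (fun x => projT1 (cid (ex x))); split.
- exact: ultra_proper.
- exact: ooU.
- by move=> x; exact: projT2 (cid (ex x)).
Qed.

(** [W] need not be Borel; a countable cover that witnesses its finite outer measure supplies a
    Borel set around it. *)
Lemma finite_outer_cover {R : realType} {G : topologicalZmodType}
    (lam : {measure set (borel G) -> \bar R}) (W : set G) :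
  has_finite_haar_measure lam W ->
  exists B : set (borel G), [/\ measurable B, (lam B < +oo)%E & W `<=` B].
Proof.
move=> [_ /ereal_inf_lt [_ [A [mA WA] <-] Afin]].
exists (\bigcup_k A k); split=> //.
  exact: bigcup_measurable.
apply: le_lt_trans Afin; apply: measure_sigma_subadditive => //.
exact: bigcup_measurable.
Qed.

Section extremal.
Context {R : realType} {G : topologicalZmodType}.
Variable lam : {measure set (borel G) -> \bar R}.
Variables (Wp Wm : set G) (B : set (borel G)).
Hypothesis mB : measurable B.
Hypothesis fB : (lam B < +oo)%E.
Hypothesis WB : Wp `<=` B.

Local Notation class := (extremal_class lam Wp Wm).

Lemma class_bounds f : class f -> [/\ real_positive_definite f,
  measurable_fun setT (f : borel G -> R),
  lam.-integrable [set: borel G] (EFin \o f),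
  (forall x, `|f x| <= 1) & (forall x, f x <= \1_B x)].
Proof.
move=> [[cf /positive_definiteP pf f0] fi fp fm]; split=> //.
- exact: borel_continuous.
- by move=> x; rewrite -f0; exact: posdef_norm_le.
move=> x; rewrite indicE; case: (boolP (x \in B)) => [_|xB].
  by rewrite (le_trans (ler_norm _))//= -f0; exact: posdef_norm_le.
rewrite leNgt; apply/negP => /fp /WB Bx; by rewrite mem_set in xB.
Qed.

Lemma class_mid f g : class f -> class g -> class (fun x => 2^-1 * (f x + g x)).
Proof.
move=> [[cf /positive_definiteP pf f0] fi fp fm].
move=> [[cg /positive_definiteP pg g0] gi gp gm].
split.
- split.
  + by move=> x; apply: cvgM; [exact: cvg_cst | apply: cvgD; [exact: cf | exact: cg]].
  + apply/positive_definiteP; apply: posdef_scale; first by rewrite invr_ge0.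
    exact: posdefD.
  + by rewrite f0 g0; field.
- exact: (integrableZl measurableT 2^-1 (integrableD measurableT fi gi)).
- move=> x /= h; have [/fp//|fx] := ltP 0 (f x); apply: gp => /=; lra.
- move=> x /= h; have [/fm//|fx] := ltP (f x) 0; apply: gm => /=; lra.
Qed.

Lemma class_sqr_integrable f : class f ->
  lam.-integrable [set: borel G] (EFin \o (fun x => f x ^+ 2)).
Proof.
move=> /class_bounds[_ mf fi f1 _]; apply: (le_integrable measurableT _ _ fi).
  by apply/measurable_EFinP; exact: measurable_funX.
move=> x _ /=; rewrite lee_fin normrX expr2 ler_piMr//.
Qed.

Lemma class_integral_le f : class f -> \int[lam]_x f x <= fine (lam B).
Proof.
move=> /class_bounds[_ mf fi f1 fB1].
have iB := integrable_indic_finite mB fB.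
apply: (@le_trans _ _ (\int[lam]_x \1_B x)).
  exact: le_Rintegral.
by rewrite /Rintegral integral_indic// setIT.
Qed.

Let energy f := \int[lam]_x (f x ^+ 2).

(** Pointwise [f ^+ 2 <= 2 * \1_B - f]: where [f > 0], [f ^+ 2 + f <= 2 * f <= 2 * \1_B], and where
    [f <= 0], [f ^+ 2 <= - f] because [f >= -1]. This controls the negative part, which is not
    confined to [B]. *)
Lemma class_energy_le f : class f -> 0 <= \int[lam]_x f x ->
  energy f <= 2 * fine (lam B).
Proof.
move=> cf f0; have [_ mf fi f1 fB1] := class_bounds cf.
have iB := integrable_indic_finite mB fB.
have i2B := integrableZl measurableT 2 iB.
have : energy f <= \int[lam]_x (2 * \1_B x - f x).
  apply: le_Rintegral => //.
  - exact: class_sqr_integrable.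
  - exact: (integrableB measurableT i2B fi).
  - move=> x _; have := f1 x; have := fB1 x; rewrite ler_norml => h1 /andP[h2 h3].
    have b0 : 0 <= \1_B x :> R by [].
    have [fx|fx] := ltP 0 (f x); nra.
rewrite RintegralB// RintegralZl//.
rewrite [X in 2 * X - _]/Rintegral integral_indic// setIT; lra.
Qed.

Lemma class_energy_dist f g : class f -> class g ->
  (\int[lam]_x ((f x - g x) ^+ 2)%:E =
  (2 * energy f + 2 * energy g - 4 * energy (fun x => 2^-1 * (f x + g x)))%:E)%E.
Proof.
move=> cf cg.
have if2 := integrableZl measurableT 2 (class_sqr_integrable cf).
have ig2 := integrableZl measurableT 2 (class_sqr_integrable cg).
have im4 := integrableZl measurableT 4 (class_sqr_integrable (class_mid cf cg)).
have iD := integrableD measurableT if2 ig2.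
have iA := integrableB measurableT iD im4.
have <- : \int[lam]_x (2 * f x ^+ 2 + 2 * g x ^+ 2 -
    4 * (2^-1 * (f x + g x)) ^+ 2) =
    2 * energy f + 2 * energy g - 4 * energy (fun x => 2^-1 * (f x + g x)).
  rewrite RintegralB// RintegralD// !RintegralZl//;
    by [exact: class_sqr_integrable | exact/class_sqr_integrable/class_mid].
rewrite /Rintegral fineK; last exact: (integrable_fin_num measurableT iA).
by apply: eq_integral => x _; congr (_%:E); field.
Qed.

Lemma maximizing_sequence f0 : class f0 -> 0 < \int[lam]_x f0 x ->
  exists (s : R) (f : nat -> G -> R), [/\ 0 < s,
    forall g, class g -> \int[lam]_x g x <= s,
    forall n, class (f n),
    forall e, 0 < e -> \forall n \near \oo, s - e <= \int[lam]_x f n x &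
    forall n, (\int[lam]_x ((f n.+1 x - f n x) ^+ 2)%:E <= (8 / 4 ^+ n)%:E)%E].
Proof.
move=> cf0 If0; pose I := [set \int[lam]_x g x | g in class].
have hI : has_sup I.
  split; first by exists (\int[lam]_x f0 x), f0.
  by exists (fine (lam B)) => _ [g cg <-]; exact: class_integral_le.
pose s := sup I.
have sub g : class g -> \int[lam]_x g x <= s.
  by move=> cg; apply: sup_ubound; [exact: hI.2 | exists g].
have s0 : 0 < s := lt_le_trans If0 (sub _ cf0).
(* The margin [s / n.+1] is at most [s], so members of [S n] have nonnegative integral, as the
   energy bound requires. *)
pose S (n : nat) : set (G -> R) :=
  [set g | class g /\ s - s / n.+1%:R <= \int[lam]_x g x].
have sn0 n : 0 < s / n.+1%:R by rewrite divr_gt0.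
have sn_le n : s / n.+1%:R <= s by rewrite ler_pdivrMr// ler_peMr ?ler1n// ltW.
have Sdec m n : (m <= n)%N -> S n `<=` S m.
  move=> mn g [cg hg]; split=> //; apply: le_trans hg; rewrite lerB//.
  by rewrite ler_pM2l// lef_pV2 ?posrE// ler_nat.
have SM n : exists2 g, S n g & energy g <= 2 * fine (lam B).
  have [_ [g cg <-] ltg] := sup_adherent (sn0 n) hI.
  exists g; first by split=> //; exact: ltW.
  apply: class_energy_le => //; apply: ltW; apply: le_lt_trans ltg.
  by rewrite subr_ge0.
have en0 g : 0 <= energy g by apply: Rintegral_ge0 => x _; exact: sqr_ge0.
have [d Hd] := near_minimal 0%N en0 SM.
pose e n : R := 1 / 4 ^+ n.
have e0 n : 0 < e n by rewrite divr_gt0// exprn_gt0.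
have [i Hi] := choice (fun n => (Hd _ (e0 n)).1).
(* Since [J n] and [J n.+1] are at least [i n], both [f n] and [f n.+1] lie in the convex set
   [S (i n)], so their midpoint has energy at least [d - e n]. The parallelogram law then gives the
   bound [8 * e n]. Also [n <= J n], which makes the sequence maximizing. *)
pose J n := \max_(k < n.+1) maxn k (i k).
have iJ n m : (n <= m)%N -> (i n <= J m)%N /\ (n <= J m)%N.
  move=> nm; have nm1 : (n < m.+1)%N by [].
  have := @leq_bigmax _ (fun k : 'I_m.+1 => maxn k (i k)) (Ordinal nm1).
  by rewrite geq_max => /andP[].
have /choice[f Hf] n : exists g : G -> R, S (J n) g /\ energy g <= d + e n.
  by have [g Sg Eg] := (Hd _ (e0 n)).2 (J n); exists g.
exists s, f; split=> //.
- by move=> n; exact: (Hf n).1.1.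
- move=> r r0.
  have [m Hm] : exists m : nat, s / m.+1%:R <= r.
    have [m] := ltr_add_invr (divr_gt0 r0 s0); rewrite add0r => hm; exists m.
    by rewrite ltW// mulrC -ltr_pdivlMr.
  exists m => // n mn; have mJ := leq_trans mn (iJ n n (leqnn n)).2.
  apply: le_trans (Sdec _ _ mJ _ (Hf n).1).2.
  by rewrite lerB.
move=> n; rewrite (class_energy_dist (Hf n.+1).1.1 (Hf n).1.1) lee_fin.
have S1 := Sdec _ _ (iJ n n.+1 (leqnSn n)).1 _ (Hf n.+1).1.
have S2 := Sdec _ _ (iJ n n (leqnn n)).1 _ (Hf n).1.
have := Hi n (fun x => 2^-1 * (f n.+1 x + f n x)).
have Sm : S (i n) (fun x => 2^-1 * (f n.+1 x + f n x)).
  split; first exact: class_mid S1.1 S2.1.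
  have i1 : lam.-integrable [set: borel G] (EFin \o f n.+1) by case: S1.1.
  have i2 : lam.-integrable [set: borel G] (EFin \o f n) by case: S2.1.
  rewrite (RintegralZl _ measurableT (integrableD measurableT i1 i2)).
  rewrite RintegralD//.
  have h1 : s - s / (i n).+1%:R <= \int[lam]_x f n.+1 x := S1.2.
  have h2 : s - s / (i n).+1%:R <= \int[lam]_x f n x := S2.2.
  rewrite -(ler_pM2l (ltr0Sn R 1)) mulrA mulfV// mul1r mulr_natl mulr2n.
  exact: lerD.
move=> /(_ Sm); have := (Hf n).2; have := (Hf n.+1).2.
have : e n.+1 <= e n.
  rewrite /e exprS ler_pM2l// lef_pV2 ?posrE ?mulr_gt0 ?exprn_gt0//.
  by rewrite ler_peMl ?exprn_ge0// ler1n.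
have -> : 8 / 4 ^+ n = 8 * e n by rewrite /e mul1r.
lra.
Qed.

End extremal.

(** * Sign conditions and the extremal function *)

(** A point [x] outside [W] lies in the closure of the exterior, by boundary coherence if it is a
    boundary point. If [Fc x > 0], continuity gives [y] in the exterior with [Fc y > 0]; but
    [F <= 0] near [y], so measures carried near [0] smear [F] to a nonpositive value there. *)
Lemma continuous_part_pos {R : realType} {G : topologicalZmodType} (W : set G)
    (F Fc : G -> R) :
  boundary_coherent W -> continuous Fc ->
  (forall e V, 0 < e -> nbhs (0 : G) V ->
      exists2 t, prob_in V t & forall x, `|Fc x - smear F t x| <= e) ->
  (forall x, 0 < F x -> W x) -> forall x, 0 < Fc x -> W x.
Proof.
move=> bcW cFc FcF FW x Fcx; apply: contrapT => nWx.
have clx : closure (exterior W) x.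
  have [clW|nclW] := pselect (closure W x); last exact: subset_closure.
  by apply: bcW; split=> // /interior_subset.
have Ox : nbhs x [set y | 0 < Fc y].
  have O0 : nbhs (Fc x) [set y | 0 < y].
    by apply: open_nbhs_nbhs; split=> //; exact: open_gt.
  exact: (cFc x _ O0).
have [y [exty /= Fcy]] := clx _ Ox.
have ext_open : open (exterior W) by exact/closed_openC/closed_closure.
have [[V1 V2] /= [V10 V20] VW] : nbhs ((0 : G), (0 : G))
    [set z : G * G | exterior W (y + (z.1 - z.2))].
  have : y + (z.1 - z.2) @[z --> ((0 : G), (0 : G))] --> y + ((0 : G) - 0).
    by apply: group_cvgD; [exact: cvg_cst | exact: (@sub_continuous G (0, 0))].
  by rewrite subrr addr0 => /(_ _ (open_nbhs_nbhs (conj ext_open exty))).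
have Fcy2 : 0 < Fc y / 2 by rewrite divr_gt0.
have [t tV /(_ y)] := FcF _ _ Fcy2 (filterI V10 V20).
have : smear F t y <= 0.
  apply: smear_le tV _ => a b [V1a _] [_ V2b]; rewrite leNgt; apply/negP => /FW.
  have /= := VW (a, b) (conj V1a V2b); rewrite addrA => nW Wab.
  by apply: nW; exact: subset_closure.
by rewrite ler_norml => h /andP[_]; lra.
Qed.

Theorem theorem17 (R : realType) (G : topologicalZmodType) (hG : lca_group G)
    (lam : {measure set (borel G) -> \bar R}) (hlam : haar_measure lam)
    (Wp Wm : set G)
    (bc_p : boundary_coherent Wp) (bc_m : boundary_coherent Wm)
    (sym_p : symmetric_set Wp) (sym_m : symmetric_set Wm)
    (nbhs_p : nbhs (0 : G) Wp) (fin_p : has_finite_haar_measure lam Wp) :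
  exists2 f : G -> R, extremal_class lam Wp Wm f &
    (\int[lam]_x (f x)%:E)%E = extremal_const lam Wp Wm.
Proof.
have [hausG lcG] := hG.
have [B [mB fB WB]] := finite_outer_cover fin_p.
(* This function makes the class nonempty and the supremum positive, which later excludes
   [Fc = 0]. *)
have [f0 [pf0 cf0 f01 f0_ge0 f0W]] := autocorrelation hausG hlam lcG nbhs_p.
have if0 : lam.-integrable [set: borel G] (EFin \o f0).
  have iB := integrable_indic_finite mB fB.
  apply: (le_integrable measurableT _ _ iB).
    by apply/measurable_EFinP; exact: borel_continuous.
  move=> x _; rewrite /= lee_fin [leRHS]ger0_norm// indicE.
  case: (boolP (x \in B)) => [_|xB]; first by rewrite -f01 posdef_norm_le.
  rewrite normr_le0 eq_le f0_ge0 andbT leNgt; apply/negP => /f0W/WB Bx.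
  by rewrite mem_set in xB.
have clf0 : extremal_class lam Wp Wm f0.
  split=> //; first by split=> //; exact/positive_definiteP.
  by move=> x /=; rewrite ltNge f0_ge0.
have If0 := integral_continuous_gt0 hausG hlam cf0 if0 f0_ge0 f01.
have [s [f [s0 les clf limf f_fast]]] := maximizing_sequence mB fB WB clf0 If0.
have bf n := class_bounds WB (clf n).
have mf n : measurable_fun setT (f n : borel G -> R) by case: (bf n).
have f1 n x : `|f n x| <= 1 by case: (bf n) => _ _ _ + _; apply.
have [N [mN N0 cvgf]] := ae_cvg_of_fast_L2 mf f_fast.
(* The ultrafilter refines convergence at infinity, so [F] agrees with the ordinary limit wherever
   that exists. *)
have [U [F [PU ooU fF]]] := ultralimit f1.
have pF : real_positive_definite F.
  by apply: (posdef_lim (U := U) (f := f)) => // n; case: (bf n).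
have F01 : F 0 = 1.
  rewrite -(cvg_lim (@norm_hausdorff _ R) (fF 0)).
  have -> : f ^~ 0 = cst 1 by apply/funext => n; have [[]] := clf n.
  exact: lim_cst.
have ge_F (a : R) x : (forall n, a <= f n x) -> a <= F x.
  move=> af; rewrite -(cvg_lim (@norm_hausdorff _ R) (fF x)).
  apply: limr_ge; first by apply/cvg_ex; exists (F x); exact: fF.
  exact: nearW.
have le_F (a : R) x : (forall n, f n x <= a) -> F x <= a.
  move=> af; rewrite -(cvg_lim (@norm_hausdorff _ R) (fF x)).
  apply: limr_le; first by apply/cvg_ex; exists (F x); exact: fF.
  exact: nearW.
have F_pos x : 0 < F x -> Wp x.
  move=> Fx; apply: contrapT => nW; move: Fx; rewrite ltNge => /negP; apply.
  apply: le_F => n; rewrite leNgt; apply/negP => fx; apply: nW.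
  by have [_ _ + _] := clf n; apply.
have F_neg x : 0 < - F x -> Wm x.
  move=> Fx; apply: contrapT => nW; move: Fx; rewrite oppr_gt0 ltNge => /negP.
  apply; apply: ge_F => n; rewrite leNgt; apply/negP => fx; apply: nW.
  by have [_ _ _] := clf n; apply.
have fN x : ~ N x -> f n x @[n --> \oo] --> F x.
  move=> nNx; have cv := cvgf x nNx.
  suff -> : F x = lim (f n x @[n --> \oo]) by exact: cv.
  rewrite -(cvg_lim (@norm_hausdorff _ R) (fF x)).
  apply: (cvg_lim (@norm_hausdorff _ R)).
  by move=> V /cv; exact: ooU.
pose g x := F x * \1_(~` N) x.
have g_in x : ~ N x -> g x = F x by move=> nNx; rewrite /g indicE mem_set ?mulr1.
have g_out x : N x -> g x = 0.
  by move=> Nx; rewrite /g indicE memNset ?mulr0// => /(_ Nx).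
have g_cases x : g x = F x \/ g x = 0.
  by have [/g_out|/g_in] := pselect (N x); [right | left].
have gN x : ~ N x -> f n x @[n --> \oo] --> g x by move=> nNx; rewrite g_in//; exact: fN.
have F1 x : `|F x| <= 1 by rewrite -F01; exact: posdef_norm_le.
have g1 x : `|g x| <= 1 by case: (g_cases x) => -> //; rewrite normr0.
have mg : measurable_fun setT (g : borel G -> R).
  apply: (@measurable_fun_cvg _ (borel G) R setT (fun n x => f n x * \1_(~` N) x)).
    move=> n; apply: measurable_funM => //; apply: measurable_indic.
    exact: measurableC.
  move=> x _; have [Nx|nNx] := pselect (N x).
    rewrite g_out//; have -> : (fun n => f n x * \1_(~` N) x) = cst 0.
      by apply/funext => n; rewrite indicE memNset ?mulr0// => /(_ Nx).
    exact: cvg_cst.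
  apply: cvgM; [exact: fN | exact: cvg_cst].
have gB x : g x <= \1_B x.
  case: (g_cases x) => ->; last by [].
  by apply: le_F => n; case: (bf n).
have ifn n : lam.-integrable [set: borel G] (EFin \o f n) by case: (bf n).
have fB1 n x : f n x <= \1_B x by case: (bf n).
have [ig sg] := fatou_dominated mB fB mN N0 ifn mg fB1 gB gN limf.
have Fg : {ae lam, forall x, F x = g x}.
  exists N; split=> // x /= nFg; apply: contrapT => nNx; apply: nFg.
  by rewrite g_in.
have [Fc [pFc cFc Fc01 FcF]] := continuous_part pF F01.
have Fc1 x : `|Fc x| <= 1 by rewrite (le_trans (posdef_norm_le pFc x)).
have [iFc IFc] := continuous_version hausG hlam mg g1 ig cFc Fc1
  (continuous_part_integral hausG hlam mg g1 Fg cFc Fc1 FcF).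
have Fc_pos := continuous_part_pos bc_p cFc FcF F_pos.
have Fc_neg x : 0 < - Fc x -> Wm x.
  (* The negative sign condition is the positive one for [- F] and [- Fc], as smearing commutes with
     negation. *)
  apply: (@continuous_part_pos _ _ Wm (fun y => - F y) (fun y => - Fc y)) => //.
    by move=> y; apply: cvgN; exact: cFc.
  move=> e V e0 V0; have [t tV Ht] := FcF e V e0 V0; exists t => // y.
  by rewrite smearN -opprD normrN.
have Fc0 : 0 < Fc 0.
  rewrite lt_neqAle eq_sym; apply/andP; split; last first.
    by rewrite (le_trans (normr_ge0 (Fc 0)))// posdef_norm_le.
  (* If [Fc 0 = 0], then [Fc] vanishes identically, although its integral is that of [g], at least
     [s > 0]. *)
  apply/eqP => Fc00; have := lt_le_trans s0 sg; rewrite -IFc.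
  have -> : Fc = cst 0.
    apply/funext => x; apply/eqP; rewrite -normr_le0 -Fc00.
    exact: posdef_norm_le.
  by rewrite Rintegral_cst// mul0r ltxx.
pose h x := (Fc 0)^-1 * Fc x.
have clh : extremal_class lam Wp Wm h.
  split.
  - split.
    + by move=> x; apply: cvgM; [exact: cvg_cst | exact: cFc].
    + by apply/positive_definiteP/posdef_scale => //; rewrite invr_ge0 ltW.
    + by rewrite /h mulVf// gt_eqF.
  - exact: (integrableZl measurableT (Fc 0)^-1 iFc).
  - by move=> x /=; rewrite /h pmulr_rgt0 ?invr_gt0//; exact: Fc_pos.
  - move=> x /=; rewrite /h pmulr_rlt0 ?invr_gt0// => Fx.
    by apply: Fc_neg; rewrite oppr_gt0.
have Ih : s <= \int[lam]_x h x.
  (* Since [0 < Fc 0 <= 1], normalizing cannot decrease the positive integral. *)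
  rewrite RintegralZl// IFc (le_trans sg)// ler_peMl ?(le_trans (ltW s0))//.
  by rewrite invf_ge1.
exists h => //; rewrite /extremal_const asboolT; last by exists h.
have toE k : extremal_class lam Wp Wm k ->
    (\int[lam]_x (k x)%:E = (\int[lam]_x k x)%:E)%E.
  by move=> [_ ik _ _]; rewrite /Rintegral fineK//; exact: (integrable_fin_num _ ik).
apply/eqP; rewrite eq_le; apply/andP; split.
  by apply: ereal_sup_ubound; exists h.
apply: ge_ereal_sup => _ [k clk <-].
by rewrite !toE// lee_fin (le_trans (les k clk)).
Qed.
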